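(* Let $\mathcal{T}_n$ denote the set of topological equivalence classes of generic two-layer 3D mosaic floor plans with $n$ blocks. Then \[ \log |\mathcal{T}_n| \geq \left(\frac{1}{3}-o(1)\right)n \log n . \]
   Context: A 3D mosaic floor plan with $n$ blocks is a partition of an axis-parallel box $H=[0,a]\times[0,b]\times[0,c]$ (the host box) into $n$ axis-parallel boxes (the blocks) with pairwise disjoint interiors. It is two-layer if there is $0<h<c$ such that the $z$-extent of every block is $[0,h]$, $[h,c]$ or $[0,c]$. A corner is a point that is a vertex of at least one block; a corner is generic if the combinatorial shape of the local arrangement of the blocks around it is stable under every sufficiently small perturbation of the blocks adjacent to it (the perturbation is local and need not extend to the whole floor plan); a floor plan is generic if all its corners are generic. Two faces of blocks are attached if their intersection has positive area; a dissection plane is the union of the faces in one class of the equivalence relation generated by attachment. For each coordinate direction, the dissection graph is the directed multigraph whose vertices are the dissection planes orthogonal to that direction, with one edge per block joining the two dissection planes containing the block's two faces orthogonal to that direction, oriented towards the larger coordinate. Two floor plans are topologically equivalent if for each of the three directions their dissection graphs are isomorphic. *)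

(* Defs.v *)
From mathcomp Require Import all_boot all_order all_algebra.
From mathcomp Require Import finmap.
From mathcomp Require Import all_classical all_reals all_analysis.

Set Implicit Arguments.
Unset Strict Implicit.
Unset Printing Implicit Defensive.

Import Order.TTheory GRing.Theory Num.Theory.
Import numFieldNormedType.Exports.

Local Open Scope classical_set_scope.
Local Open Scope ring_scope.

(* Coordinate directions are indexed by 'I_3; the vertical one is the last. *)
Definition zdir : 'I_3 := ord_max.

Definition point3 (R : realType) := 'I_3 -> R.

Record box (R : realType) := Box { lo : point3 R; hi : point3 R }.

Definition nondegenerate (R : realType) (B : box R) : Prop :=
  forall d, lo B d < hi B d.

Definition box_set (R : realType) (B : box R) : set (point3 R) :=
  [set p | forall d, lo B d <= p d <= hi B d].

Definition box_interior (R : realType) (B : box R) : set (point3 R) :=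
  [set p | forall d, lo B d < p d < hi B d].

(* The labelling of the blocks by 'I_n carries no information: the notion of
   equivalence below is invariant under relabelling. *)
Record floorplan (R : realType) (n : nat) := Floorplan {
  host : box R;
  block : 'I_n -> box R;
  host_origin : forall d, lo host d = 0;
  host_nondegenerate : nondegenerate host;
  block_nondegenerate : forall i, nondegenerate (block i);
  block_cover : \bigcup_i box_set (block i) = box_set host;
  block_disjoint : forall i j, i != j ->
    box_interior (block i) `&` box_interior (block j) = set0
}.

Definition two_layer (R : realType) (n : nat) (F : floorplan R n) : Prop :=
  exists h : R, 0 < h < hi (host F) zdir /\
    forall i, let z := (lo (block F i) zdir, hi (block F i) zdir) in
      [\/ z = (0, h), z = (h, hi (host F) zdir) | z = (0, hi (host F) zdir)].

Definition box_vertex (R : realType) (B : box R) (p : point3 R) : Prop :=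
  forall d, p d = lo B d \/ p d = hi B d.

Definition corner (R : realType) (n : nat) (F : floorplan R n) (p : point3 R) :
  Prop := exists i, box_vertex (block F i) p.

Definition adjacent (R : realType) (n : nat) (F : floorplan R n) (p : point3 R)
  (i : 'I_n) : Prop := box_set (block F i) p.

(* An octant is a choice of sign in each direction. [occupies B p s] says that
   the part of the octant s at p that is close to p lies in B, i.e. that
   p + t s is in the interior of B for all small t > 0. *)
Definition octant := 'I_3 -> bool.

Definition occupies (R : realType) (B : box R) (p : point3 R) (s : octant) :
  Prop :=
  forall d, if s d then lo B d <= p d < hi B d else lo B d < p d <= hi B d.

(* B' moves every coordinate of every block adjacent to p by less than e, in
   such a way that the moved blocks have pairwise disjoint interiors and still
   fill the part of the host box at distance less than r from p. The blocks
   not adjacent to p play no role. *)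
Definition local_perturbation (R : realType) (n : nat) (F : floorplan R n)
  (p : point3 R) (r e : R) (B' : 'I_n -> box R) : Prop :=
  [/\ forall i, adjacent F p i -> forall d,
        `|lo (B' i) d - lo (block F i) d| < e /\
        `|hi (B' i) d - hi (block F i) d| < e,
      forall i j, adjacent F p i -> adjacent F p j -> i != j ->
        box_interior (B' i) `&` box_interior (B' j) = set0 &
      forall q : point3 R, (forall d, `|q d - p d| < r) ->
        (box_set (host F) q <->
         exists i, adjacent F p i /\ box_set (B' i) q)].

(* The combinatorial shape of the arrangement at a point is the assignment, to
   each of the 8 octants, of the block occupying it (none outside the host). *)
Definition same_shape (R : realType) (n : nat) (F : floorplan R n)
  (p : point3 R) (B' : 'I_n -> box R) (p' : point3 R) : Prop :=
  forall i, adjacent F p i -> forall s : octant,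
    occupies (block F i) p s <-> occupies (B' i) p' s.

(* Perturbations of size less than e are considered on the r-neighbourhood of p;
   the condition gets stronger as r decreases, so that it is about arbitrarily
   small r, for which the r-neighbourhood meets only blocks adjacent to p. *)
Definition generic_corner (R : realType) (n : nat) (F : floorplan R n)
  (p : point3 R) : Prop :=
  forall r : R, 0 < r -> exists e : R, 0 < e /\
    forall B' : 'I_n -> box R, local_perturbation F p r e B' ->
      exists p' : point3 R, same_shape F p B' p'.

Definition generic (R : realType) (n : nat) (F : floorplan R n) : Prop :=
  forall p, corner F p -> generic_corner F p.

(* The faces orthogonal to a given direction: (i, false) is the lower face of
   the block i and (i, true) its upper face. *)
Definition face (n : nat) := ('I_n * bool)%type.

Definition face_coord (R : realType) (n : nat) (F : floorplan R n) (d : 'I_3)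
  (f : face n) : R :=
  if f.2 then hi (block F f.1) d else lo (block F f.1) d.

Definition overlap_area (R : realType) (n : nat) (F : floorplan R n)
  (d : 'I_3) (f g : face n) : R :=
  if face_coord F d f == face_coord F d g then
    \prod_(k < 3 | k != d)
      Num.max 0 (Num.min (hi (block F f.1) k) (hi (block F g.1) k)
                 - Num.max (lo (block F f.1) k) (lo (block F g.1) k))
  else 0.

(* Faces orthogonal to different directions meet in a null set, so that only
   faces orthogonal to the same direction can be attached. *)
Definition attached (R : realType) (n : nat) (F : floorplan R n) (d : 'I_3) :
  rel (face n) := [rel f g | 0 < overlap_area F d f g].

(* As [attached] is symmetric, [connect] gives the generated equivalence. *)
Definition plane_of (R : realType) (n : nat) (F : floorplan R n) (d : 'I_3)
  (f : face n) : {set face n} := [set g | connect (attached F d) f g]%SET.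

(* A dissection plane is represented by its class of faces; two distinct
   classes have unions that overlap in a null set, hence are distinct. *)
Definition dissection_plane (R : realType) (n : nat) (F : floorplan R n)
  (d : 'I_3) := {P : {set face n} | [exists f, P == plane_of F d f]}.

Lemma plane_ofP (R : realType) (n : nat) (F : floorplan R n) (d : 'I_3)
  (f : face n) : [exists g, plane_of F d f == plane_of F d g].
Proof. by apply/existsP; exists f. Qed.

Definition plane (R : realType) (n : nat) (F : floorplan R n) (d : 'I_3)
  (f : face n) : dissection_plane F d :=
  exist _ (plane_of F d f) (plane_ofP F d f).

Record multidigraph := Multidigraph {
  vertex : Type;
  edge : Type;
  source : edge -> vertex;
  target : edge -> vertex
}.

Definition isomorphic (G H : multidigraph) : Prop :=
  exists (phi : vertex G -> vertex H) (psi : edge G -> edge H),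
    [/\ bijective phi, bijective psi,
        forall a, source (psi a) = phi (source a) &
        forall a, target (psi a) = phi (target a)].

Definition dissection_graph (R : realType) (n : nat) (F : floorplan R n)
  (d : 'I_3) : multidigraph :=
  @Multidigraph (dissection_plane F d) 'I_n
    (fun i => plane F d (i, false)) (fun i => plane F d (i, true)).

Definition topologically_equivalent (R : realType) (n : nat)
  (F G : floorplan R n) : Prop :=
  forall d, isomorphic (dissection_graph F d) (dissection_graph G d).

Definition generic_two_layer (R : realType) (n : nat) :
  set (floorplan R n) := [set F | two_layer F /\ generic F].

Definition equivalence_class (R : realType) (n : nat) (F : floorplan R n) :
  set (floorplan R n) :=
  [set G | generic_two_layer G /\ topologically_equivalent F G].

Definition T_classes (R : realType) (n : nat) : set (set (floorplan R n)) :=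
  [set equivalence_class F | F in @generic_two_layer R n].

(* [fset_set] sends an infinite set to the empty one; T_classes is finite since
   a dissection graph has n edges and no isolated vertex. *)
Definition card_T (R : realType) (n : nat) : nat :=
  #|` fset_set (@T_classes R n)|%fset.

(* Main.v *)
(**
Put full-height unit pillars on a rectangular grid, at points with odd
coordinates, and fill the rest of the bottom layer with unit-wide columns and the
rest of the top layer with unit-wide rows, both cut by the pillars. As the
even columns and rows are uncut, no two pillars touch and around every corner all
the walls orthogonal to a given direction are glued together, so that the floor
plan is generic. With k pillars there are 3 k blocks, up to the numbers of columns
and rows.

In the dissection graph of the x-direction, the bottom layer provides a directed
path through all the coordinates, which pins down the coordinate of every interior
plane. The graph hence determines the pairs (x, x') such that x and x' are the
abscissae of consecutive pillars of a row.

Take m + 1 groups of columns and m * m * P rows indexed by (i, k, a), each with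
one pillar per group. In an even group the rows with first index i use P columns
of their own, in an odd group those with second index k do, and within these P
columns the row (i, k, a) uses the a-th one up to a permutation depending on the
group, i and k. Going from group to group, the pairs (x, x') reveal i, k and the
permutations. This gives (P!) ^ (m ^ 3) classes with (3 + O(1 / m)) m ^ 3 P
blocks. *)

From mathcomp Require Import all_boot all_order all_algebra.
From mathcomp Require Import perm finmap.
From mathcomp Require Import all_classical all_reals all_analysis.
From mathcomp Require Import zify ring lra.
Require Import Defs.
Set Implicit Arguments.
Unset Strict Implicit.
Unset Printing Implicit Defensive.
Import Order.TTheory GRing.Theory Num.Theory.
Import numFieldNormedType.Exports.
Local Open Scope classical_set_scope.
Local Open Scope ring_scope.

(* [lia] is very slow in the presence of hypotheses on real numbers. *)
Ltac nat_lia :=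
  repeat match goal with
  | H : context [@Order.le] |- _ => clear H
  | H : context [@Order.lt] |- _ => clear H
  end; lia.

(** * Floor plans with integer coordinates *)

Definition cell := 'I_3 -> nat.

Definition subst_coord (c : cell) (d : 'I_3) (x : nat) : cell :=
  fun k => if k == d then x else c k.

Lemma subst_coordE c d x : subst_coord c d x d = x.
Proof. by rewrite /subst_coord eqxx. Qed.

Lemma subst_coord_neq c d x k : k != d -> subst_coord c d x k = c k.
Proof. by rewrite /subst_coord => /negbTE ->. Qed.

Definition in_cells (l h c : cell) : Prop := forall d, (l d <= c d < h d)%N.

Definition grid_tiling (n : nat) (D : cell) (l h : 'I_n -> cell) : Prop :=
  [/\ forall i d, (l i d < h i d <= D d)%N,
      forall c, (forall d, c d < D d)%N -> exists i, in_cells (l i) (h i) c &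
      forall c i j, in_cells (l i) (h i) c -> in_cells (l j) (h j) c -> i = j].

(* The cell c, with its d-coordinate ignored, is one of the four quadrants of
   the plane through P orthogonal to d; i and j are the blocks just below and
   just above that plane in this quadrant. *)
Definition wall (n : nat) (D : cell) (l h : 'I_n -> cell) (P : cell) (d : 'I_3)
    (c : cell) (i j : 'I_n) : Prop :=
  [/\ forall k, k != d -> [&& c k <= P k, P k <= (c k).+1 & c k < D k]%N,
      in_cells (l i) (h i) (subst_coord c d (P d).-1),
      in_cells (l j) (h j) (subst_coord c d (P d)) & i <> j].

(* All walls at P orthogonal to d must move together as soon as the two blocks
   of each wall stay in contact. *)
Definition rigid_walls (R : realType) (n : nat) (D : cell) (l h : 'I_n -> cell) :
  Prop := forall (P : cell) (d : 'I_3), (0 < P d < D d)%N ->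
    forall u w : 'I_n -> R,
      (forall c i j, wall D l h P d c i j -> u i = w j) ->
      forall c i j c' i' j', wall D l h P d c i j -> wall D l h P d c' i' j' ->
        u i = u i'.

Section GridFloorplan.
Context {R : realType} {n : nat} (D : cell) (l h : 'I_n -> cell).
Hypothesis D_gt0 : forall d, (0 < D d)%N.
Hypothesis tiling : grid_tiling D l h.

Let lh i d : (l i d < h i d)%N. Proof. by case: tiling => + _ _ => /(_ i d)/andP[]. Qed.
Let hD i d : (h i d <= D d)%N. Proof. by case: tiling => + _ _ => /(_ i d)/andP[]. Qed.
Let cover c : (forall d, c d < D d)%N -> exists i, in_cells (l i) (h i) c.
Proof. by case: tiling => _ + _; exact. Qed.
Let unique c i j : in_cells (l i) (h i) c -> in_cells (l j) (h j) c -> i = j.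
Proof. by case: tiling => _ _; apply. Qed.

Definition natbox (a b : cell) : box R :=
  Box (fun d => (a d)%:R) (fun d => (b d)%:R).

Lemma natbox_cover : \bigcup_i box_set (natbox (l i) (h i)) =
  box_set (natbox (fun=> 0%N) D).
Proof.
apply/seteqP; split => [p [i _ ip] d | p pD] /=.
  have /andP[lp ph] := ip d; apply/andP; split; first exact: le_trans lp.
  by apply: le_trans ph _; rewrite /= ler_nat.
(* The cap [(D d).-1] puts the points of the upper faces of the host into the last cell. *)
pose c d := minn (Num.truncn (p d)) (D d).-1.
have cP d : (c d)%:R <= p d <= (c d).+1%:R /\ (c d < D d)%N.
  have /andP[p0 pd] := pD d; have /andP[tp pt] := truncn_itv p0.
  rewrite /c; have := D_gt0 d; case: (leqP (Num.truncn (p d)) (D d).-1) => tD D0.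
    by rewrite tp (ltW pt); split=> //; lia.
  rewrite prednK // pd andbT; split=> //.
  by apply: le_trans tp; rewrite ler_nat ltnW.
have [i ic] := cover (fun d => (cP d).2).
exists i => // d; have [/andP[cp pc] _] := cP d; have /andP[lc ch] := ic d.
by rewrite /= (le_trans _ cp) ?ler_nat //= (le_trans pc) // ler_nat.
Qed.

(** Reduces the disjointness of the interiors to the fact that a cell belongs to a single block. *)
Lemma natbox_interior_cell (a b : cell) (p : point3 R) :
  box_interior (natbox a b) p -> in_cells a b (fun d => Num.truncn (p d)).
Proof.
move=> ip d; have /andP[/= ap pb] := ip d.
have p0 : 0 <= p d by apply: le_trans (ltW ap).
have /andP[tp pt] := truncn_itv p0.
rewrite -(ltr_nat R) (le_lt_trans tp pb) andbT -ltnS -(ltr_nat R).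
exact: lt_trans pt.
Qed.

Lemma natbox_disjoint i j : i != j ->
  box_interior (natbox (l i) (h i)) `&` box_interior (natbox (l j) (h j)) = set0.
Proof.
move=> /eqP ij; rewrite -subset0 => p [/natbox_interior_cell ip /natbox_interior_cell jp].
exact/ij/unique/jp.
Qed.

Lemma natbox_host_nondegenerate : nondegenerate (natbox (fun=> 0%N) D).
Proof. by move=> d; rewrite /= ltr_nat. Qed.

Lemma natbox_nondegenerate i : nondegenerate (natbox (l i) (h i)).
Proof. by move=> d; rewrite /= ltr_nat. Qed.

Definition grid_floorplan : floorplan R n :=
  @Floorplan R n (natbox (fun=> 0%N) D) (fun i => natbox (l i) (h i))
    (fun=> erefl) natbox_host_nondegenerate natbox_nondegenerate natbox_cover
    natbox_disjoint.

(** * Perturbations around a grid point *)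

Section Perturbation.
Context (P : cell) (r e : R) (B' : 'I_n -> box R).
Let p : point3 R := fun d => (P d)%:R.
Hypothesis e_gt0 : 0 < e.
Hypothesis e_small : 8 * e <= 1.
Hypothesis e_r : 2 * e < r.
Hypothesis PP : local_perturbation grid_floorplan p r e B'.

Let adjP i : adjacent grid_floorplan p i <-> forall d, (l i d <= P d <= h i d)%N.
Proof.
split=> H d; have := H d; first by rewrite /= !ler_nat.
by rewrite /p /= !ler_nat.
Qed.

Let near i d : adjacent grid_floorplan p i ->
  ((l i d)%:R - e < lo (B' i) d < (l i d)%:R + e) /\
  ((h i d)%:R - e < hi (B' i) d < (h i d)%:R + e).
Proof.
by case: PP => + _ _ => /[apply]/(_ d) [/=]; rewrite !ltr_distl.
Qed.

Definition quadrant (d : 'I_3) (c : cell) :=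
  forall k, k != d -> [&& c k <= P k, P k <= (c k).+1 & c k < D k]%N.

(** A test point in the quadrant of [c]. Faces move by less than [e], so the offset [2 * e] keeps it
    on the right side of the moved faces orthogonal to the directions other than [d], while
    [2 * e < r] keeps it where the covering is controlled. *)
Definition witness (d : 'I_3) (c : cell) (x : R) : point3 R := fun k =>
  if k == d then x else if c k == P k then p k + 2 * e else p k - 2 * e.

Lemma cell_adjacent d c x i : quadrant d c -> (x <= P d <= x.+1)%N ->
  in_cells (l i) (h i) (subst_coord c d x) -> adjacent grid_floorplan p i.
Proof.
move=> qc Px ic; apply/adjP => k; have := ic k.
case: (eqVneq k d) => [->|kd]; first by rewrite subst_coordE; nat_lia.
by rewrite subst_coord_neq //; have := qc k kd; nat_lia.
Qed.

Local Ltac split_lra :=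
  move: e_gt0 e_small e_r => ? ? ?; repeat (apply/andP; split); lra.

Lemma natS_le (a b : nat) : (a < b)%N -> a%:R + 1 <= b%:R :> R.
Proof. by rewrite -(ler_nat R) -natr1. Qed.

Lemma witness_in d c (x : R) i k : quadrant d c -> adjacent grid_floorplan p i ->
  k != d -> (l i k <= c k < h i k)%N ->
  lo (B' i) k < witness d c x k < hi (B' i) k.
Proof.
move=> qc ai kd /andP[lc ch]; have /and3P[cP Pc cD] := qc k kd.
have [/andP[l1 l2] /andP[h1 h2]] := near k ai.
rewrite /witness (negbTE kd) /p; case: (eqVneq (c k) (P k)) => E.
  have := natS_le ch; move: lc; rewrite -(ler_nat R) E => lc ?; split_lra.
have cE : P k = (c k).+1 by nat_lia.
have lP : (l i k < P k)%N by nat_lia.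
have := natS_le lP; move: ch; rewrite cE -(ler_nat R) => ?; split_lra.
Qed.

Lemma witness_in_cell d c x i k : quadrant d c -> adjacent grid_floorplan p i ->
  k != d -> lo (B' i) k <= witness d c x k <= hi (B' i) k ->
  (l i k <= c k < h i k)%N.
Proof.
move=> qc ai kd; have /and3P[cP Pc cD] := qc k kd.
have [/andP[l1 l2] /andP[h1 h2]] := near k ai.
have /andP[lP Ph] := (adjP i).1 ai k.
rewrite /witness (negbTE kd) /p; case: (eqVneq (c k) (P k)) => E /andP[w1 w2].
  rewrite E lP /= -(ltr_nat R); split_lra.
have cE : P k = (c k).+1 by nat_lia.
rewrite -cE Ph andbT -ltnS -cE -(ltr_nat R); split_lra.
Qed.

Lemma witness_host d c x k : quadrant d c -> k != d ->
  0 <= witness d c x k <= (D k)%:R.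
Proof.
move=> qc kd; have /and3P[cP Pc cD] := qc k kd.
rewrite /witness (negbTE kd) /p; case: (eqVneq (c k) (P k)) => E.
  have := natS_le cD; have := ler0n R (P k); rewrite E; split_lra.
have cE : P k = (c k).+1 by nat_lia.
move: cD; rewrite cE -(ler_nat R) -natr1; have := ler0n R (c k); split_lra.
Qed.

Lemma witness_near d c (x : R) k : p d - e < x < p d + e -> `|witness d c x k - p k| < r.
Proof.
rewrite ltr_distl /witness; have [->|kd] := eqVneq k d; first split_lra.
by case: ifP; split_lra.
Qed.

(* A point of the host near P is covered by a moved block, and off the plane
   orthogonal to d it can only be one of the blocks that were there before. *)
Lemma witness_covered d c (x : R) : quadrant d c -> p d - e < x < p d + e ->
  0 <= x <= (D d)%:R -> exists i, [/\ adjacent grid_floorplan p i,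
    lo (B' i) d <= x <= hi (B' i) d &
    in_cells (l i) (h i) (subst_coord c d (P d).-1) \/
    in_cells (l i) (h i) (subst_coord c d (P d))].
Proof.
move=> qc xP xD.
have wh : box_set (host grid_floorplan) (witness d c x).
  move=> k; case: (eqVneq k d) => [->|kd]; last exact: witness_host.
  by rewrite /witness eqxx.
case: PP => _ _ /(_ (witness d c x) (fun k => witness_near c k xP)) [/(_ wh) + _].
move=> [i [ai iw]]; exists i; split=> //.
  by have := iw d; rewrite /witness eqxx.
have ic k (kd : k != d) := witness_in_cell qc ai kd (iw k).
have ad := (adjP i).1 ai d; have lhd := lh i d.
have [lP|lP] := leqP (P d) (l i d); [right|left] => k;
  (have [->|kd] := eqVneq k d; [rewrite subst_coordE; nat_lia
                               |rewrite subst_coord_neq //; exact: ic]).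
Qed.

(** Take the test point midway between the two moved faces. If the faces part, no moved block can
    cover it; if they cross, it is interior to both moved blocks. *)
Lemma wall_contact d c i j : (0 < P d < D d)%N -> wall D l h P d c i j ->
  hi (B' i) d = lo (B' j) d.
Proof.
move=> Pd [qc ic jc ij].
have ai : adjacent grid_floorplan p i.
  by apply: cell_adjacent ic => //; nat_lia.
have aj : adjacent grid_floorplan p j.
  by apply: cell_adjacent jc => //; nat_lia.
(* If [i] went past the plane, it would contain the cell above, which belongs to [j]. *)
have hiP : h i d = P d.
  have := ic d; rewrite subst_coordE => icd.
  case: (leqP (h i d) (P d)) => [|Ph]; first by nat_lia.
  case: ij; apply: unique jc => k; have := ic k.
  by have [->|kd] := eqVneq k d; [rewrite !subst_coordE; nat_lia
                                 |rewrite !subst_coord_neq].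
have ljP : l j d = P d.
  have := jc d; rewrite subst_coordE => jcd.
  case: (leqP (P d) (l j d)) => [|Ph]; first by nat_lia.
  case: ij; apply: unique ic _ => k; have := jc k.
  by have [->|kd] := eqVneq k d; [rewrite !subst_coordE; nat_lia
                                 |rewrite !subst_coord_neq].
have [_] := near d ai; rewrite hiP => /andP[h1 h2].
have [+ _] := near d aj; rewrite ljP => /andP[l1 l2].
have [li _] := near d ai; have [_ hj] := near d aj.
have liP : (l i d < P d)%N by rewrite -hiP; exact: lh.
have hjP : (P d < h j d)%N by rewrite -ljP; exact: lh.
move/natS_le: liP; move/natS_le: hjP => hjP liP.
set x := (hi (B' i) d + lo (B' j) d) / 2.
have xP : p d - e < x < p d + e by rewrite /x /p; split_lra.
apply/eqP; case: ltgtP => // hl.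
  have xD : 0 <= x <= (D d)%:R.
    have : (P d)%:R + 1 <= (D d)%:R :> R by apply: natS_le; nat_lia.
    have : 1 <= (P d)%:R :> R by rewrite ler1n; nat_lia.
    by rewrite /x; split_lra.
  have [t [_ tx [tc|tc]]] := witness_covered qc xP xD.
    by move: tx; rewrite (unique tc ic) /x; split_lra.
  by move: tx; rewrite (unique tc jc) /x; split_lra.
have iw k : lo (B' i) k < witness d c x k < hi (B' i) k.
  have [->|kd] := eqVneq k d; first by rewrite /witness eqxx /x; split_lra.
  by apply: witness_in => //; have := ic k; rewrite subst_coord_neq.
have jw k : lo (B' j) k < witness d c x k < hi (B' j) k.
  have [->|kd] := eqVneq k d; first by rewrite /witness eqxx /x; split_lra.
  by apply: witness_in => //; have := jc k; rewrite subst_coord_neq.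
case: PP => _ /(_ _ _ ai aj (introN eqP ij)) + _.
by move/seteqP => [/(_ (witness d c x))] /(_ (conj iw jw)).
Qed.

Lemma block_quadrant d i : adjacent grid_floorplan p i -> exists c,
  quadrant d c /\ forall k, k != d -> (l i k <= c k < h i k)%N.
Proof.
move=> ai; exists (fun k => if (P k < h i k)%N then P k else (P k).-1).
by split=> k _ /=; have := (adjP i).1 ai k; have := lh i k; have := hD i k;
  case: (ltnP (P k) (h i k)); nat_lia.
Qed.

(** A face on the boundary of the host is fixed: moved outwards, its block would stick out of the
    host; moved inwards, it would uncover a point, since the cell of the quadrant belongs to this
    block alone. *)
Lemma low_boundary d i : P d = 0%N -> adjacent grid_floorplan p i ->
  lo (B' i) d = 0.
Proof.
move=> Pd ai; have [c [qc ic]] := block_quadrant d ai.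
have il : l i d = 0%N by have := (adjP i).1 ai d; nat_lia.
have [+ hn] := near d ai; rewrite il => /andP[l1 l2].
have Dd : 1 <= (D d)%:R :> R by rewrite ler1n.
have hd : 1 <= (h i d)%:R :> R by rewrite ler1n; have := lh i d; nat_lia.
set x := lo (B' i) d / 2.
have xP : p d - e < x < p d + e by rewrite /x /p Pd; split_lra.
apply/eqP; case: ltgtP => // lo0.
  have iw : box_set (B' i) (witness d c x).
    move=> k; have [->|kd] := eqVneq k d; first by rewrite /witness eqxx /x; split_lra.
    by have /andP[/ltW -> /ltW ->] := witness_in x qc ai kd (ic k kd).
  case: PP => _ _ /(_ (witness d c x) (fun k => witness_near c k xP)) [_].
  by move=> /(_ (ex_intro _ i (conj ai iw)))/(_ d); rewrite /witness eqxx /= /x; split_lra.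
have xD : 0 <= x <= (D d)%:R by rewrite /x; split_lra.
have icc : in_cells (l i) (h i) (subst_coord c d 0).
  by move=> k; have [->|kd] := eqVneq k d;
    [rewrite subst_coordE; have := lh i d; nat_lia|rewrite subst_coord_neq ?ic].
have [t [_ tx tc]] := witness_covered qc xP xD.
have ti : t = i by apply: unique icc; move: tc; rewrite Pd => -[].
by move: tx; rewrite ti /x; split_lra.
Qed.

Lemma high_boundary d i : P d = D d -> adjacent grid_floorplan p i ->
  hi (B' i) d = (D d)%:R.
Proof.
move=> Pd ai; have [c [qc ic]] := block_quadrant d ai.
have hE : h i d = D d by have := (adjP i).1 ai d; have := hD i d; nat_lia.
have [ln] := near d ai; rewrite hE => /andP[h1 h2].
have Dd : 1 <= (D d)%:R :> R by rewrite ler1n.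
have lid : (l i d)%:R + 1 <= (D d)%:R :> R by apply: natS_le; rewrite -hE.
set x := (hi (B' i) d + (D d)%:R) / 2.
have xP : p d - e < x < p d + e by rewrite /x /p Pd; split_lra.
apply/eqP; case: ltgtP => // hi0; last first.
  have iw : box_set (B' i) (witness d c x).
    move=> k; have [->|kd] := eqVneq k d; first by rewrite /witness eqxx /x; split_lra.
    by have /andP[/ltW -> /ltW ->] := witness_in x qc ai kd (ic k kd).
  case: PP => _ _ /(_ (witness d c x) (fun k => witness_near c k xP)) [_].
  by move=> /(_ (ex_intro _ i (conj ai iw)))/(_ d); rewrite /witness eqxx /= /x; split_lra.
have xD : 0 <= x <= (D d)%:R by rewrite /x; split_lra.
have icc : in_cells (l i) (h i) (subst_coord c d (D d).-1).
  by move=> k; have [->|kd] := eqVneq k d;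
    [rewrite subst_coordE; have := lh i d; nat_lia|rewrite subst_coord_neq ?ic].
have [t [_ tx [tc|tc]]] := witness_covered qc xP xD.
  by move: tx; rewrite Pd in tc; rewrite (unique tc icc) /x; split_lra.
by have := tc d; have := hD t d; rewrite subst_coordE; nat_lia.
Qed.

Hypothesis rigid : rigid_walls R D l h.

(** At an interior coordinate every face is a side of a wall, and contact together with rigidity
    gives all walls the same position; on the boundary of the host the faces do not move. The value
    [v] serves as a coordinate of the moved corner. *)
Lemma moved_coordinate d : exists2 v : R, p d - e < v < p d + e &
  forall i, adjacent grid_floorplan p i ->
    (l i d = P d -> lo (B' i) d = v) /\ (h i d = P d -> hi (B' i) d = v).
Proof.
have pe : p d - e < p d < p d + e by split_lra.
have [Pd0|Pd0] := posnP (P d).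
  exists (p d) => // i ai; rewrite /p Pd0; split=> [_|hi0].
    exact: low_boundary.
  by have := lh i d; rewrite hi0.
have [PD|PD] := leqP (D d) (P d).
  have [[k Dk]|Q] := pselect (exists i, adjacent grid_floorplan p i); last first.
    by exists (p d) => // i ai; case: Q; exists i.
  have PDE : P d = D d.
    by have := (adjP k).1 Dk d; have := hD k d; nat_lia.
  exists (p d) => // i ai; rewrite /p PDE; split=> [li|_].
    by have := lh i d; have := hD i d; nat_lia.
  exact: high_boundary.
have Pd : (0 < P d < D d)%N by rewrite Pd0.
have upper i : adjacent grid_floorplan p i -> h i d = P d ->
    exists c j, wall D l h P d c i j.
  move=> ai hiP; have [c [qc ic]] := block_quadrant d ai.
  have [j jc] : exists j, in_cells (l j) (h j) (subst_coord c d (P d)).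
    apply: cover => k; have [->|kd] := eqVneq k d; first by rewrite subst_coordE.
    by rewrite subst_coord_neq //; have := qc k kd; nat_lia.
  exists c, j; split=> //.
    move=> k; have [->|kd] := eqVneq k d; last by rewrite subst_coord_neq ?ic.
    by rewrite subst_coordE; have := lh i d; nat_lia.
  by move=> ij; have := jc d; rewrite -ij subst_coordE hiP; nat_lia.
have lower j : adjacent grid_floorplan p j -> l j d = P d ->
    exists c i, wall D l h P d c i j.
  move=> aj ljP; have [c [qc jc]] := block_quadrant d aj.
  have [i ic] : exists i, in_cells (l i) (h i) (subst_coord c d (P d).-1).
    apply: cover => k; have [->|kd] := eqVneq k d; first by rewrite subst_coordE; nat_lia.
    by rewrite subst_coord_neq //; have := qc k kd; nat_lia.
  exists c, i; split=> //.
    move=> k; have [->|kd] := eqVneq k d; last by rewrite subst_coord_neq ?jc.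
    by rewrite subst_coordE; have := lh j d; nat_lia.
  by move=> ij; have := ic d; rewrite ij subst_coordE ljP; nat_lia.
have contact c i j : wall D l h P d c i j -> hi (B' i) d = lo (B' j) d.
  exact: wall_contact.
(* Without walls no adjacent block has a face in this plane, and any value near [p d] would do. *)
have [[c0 [i0 [j0 w0]]]|no] := pselect (exists c i j, wall D l h P d c i j);
  last first.
  exists (p d) => // i ai; split=> E; case: no.
    by have [c [j ?]] := lower i ai E; exists c, j, i.
  by have [c [j ?]] := upper i ai E; exists c, i, j.
have eqv := @rigid P d Pd (fun i => hi (B' i) d) (fun i => lo (B' i) d) contact.
have main i : adjacent grid_floorplan p i ->
    (l i d = P d -> lo (B' i) d = hi (B' i0) d) /\
    (h i d = P d -> hi (B' i) d = hi (B' i0) d).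
  move=> ai; split=> E.
    have [c [j w]] := lower i ai E.
    by rewrite -(contact _ _ _ w); exact: eqv w w0.
  have [c [j w]] := upper i ai E; exact: eqv w w0.
exists (hi (B' i0) d) => //.
case: (w0) => qc ic jc ij.
have ai : adjacent grid_floorplan p i0 by apply: cell_adjacent ic => //; nat_lia.
have hiP : h i0 d = P d.
  have := ic d; rewrite subst_coordE => icd.
  case: (leqP (h i0 d) (P d)) => [|Ph]; first by nat_lia.
  case: ij; apply: unique jc => k; have := ic k.
  by have [->|kd] := eqVneq k d; [rewrite !subst_coordE; nat_lia
                                 |rewrite !subst_coord_neq].
by have [_] := near d ai; rewrite hiP.
Qed.

(** Occupation only depends on how the corner compares with the faces of the block. Faces through
    [p] move along with [p']; the others are at distance at least 1 from [p], too far to be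
    crossed. *)
Lemma perturbed_shape : exists p', same_shape grid_floorplan p B' p'.
Proof.
have /choice[p' p'P] : forall d, exists v, p d - e < v < p d + e /\
  forall i, adjacent grid_floorplan p i ->
    (l i d = P d -> lo (B' i) d = v) /\ (h i d = P d -> hi (B' i) d = v).
  by move=> d; have [v ? ?] := moved_coordinate d; exists v.
exists p' => i ai s.
have E d : (if s d then lo (block grid_floorplan i) d <= p d < hi (block grid_floorplan i) d
   else lo (block grid_floorplan i) d < p d <= hi (block grid_floorplan i) d) =
   (if s d then lo (B' i) d <= p' d < hi (B' i) d else lo (B' i) d < p' d <= hi (B' i) d).
  have [pe /(_ i ai)[lE hE]] := p'P d.
  have [ln hn] := near d ai; have /andP[lP Ph] := (adjP i).1 ai d.
  have lhd := natS_le (lh i d); rewrite /= /p !ler_nat !ltr_nat lP Ph.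
  move: pe; rewrite /p => pe.
  have El : (l i d < P d)%N = (lo (B' i) d < p' d).
    have [lP'|lP'] := ltnP (l i d) (P d); apply/esym.
      by have := natS_le lP'; split_lra.
    by rewrite lE ?ltxx //; nat_lia.
  have Eh : (P d < h i d)%N = (p' d < hi (B' i) d).
    have [lP'|lP'] := ltnP (P d) (h i d); apply/esym.
      by have := natS_le lP'; split_lra.
    by rewrite hE ?ltxx //; nat_lia.
  have El' : lo (B' i) d <= p' d.
    have [lP'|lP'] := ltnP (l i d) (P d); first by rewrite ltW -?El.
    by rewrite lE //; nat_lia.
  have Eh' : p' d <= hi (B' i) d.
    have [lP'|lP'] := ltnP (P d) (h i d); first by rewrite ltW -?Eh.
    by rewrite hE //; nat_lia.
  by rewrite El Eh El' Eh'.
by split=> H d; have := H d; rewrite E.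
Qed.

End Perturbation.

Lemma grid_generic : rigid_walls R D l h -> generic grid_floorplan.
Proof.
move=> rigid p [i ip] r r0.
have {i ip}[P PE] : exists P : cell, p = (fun d => (P d)%:R).
  have /choice[P HP] : forall d, exists x : nat, p d = x%:R.
    by move=> d; case: (ip d) => ->; [exists (l i d)|exists (h i d)].
  by exists P; apply/funext.
(* 1/8 makes the moves small against the unit grid; [r / 4] keeps the test points at distance less
   than [r]. *)
exists (Num.min 8^-1 (r / 4)); split; first by rewrite lt_min; apply/andP; split; lra.
move=> B' pert; rewrite PE in pert *; apply: perturbed_shape pert rigid.
- by rewrite lt_min; apply/andP; split; lra.
- have : Num.min 8^-1 (r / 4) <= 8^-1 by rewrite ge_min lexx.
  lra.
- have : Num.min 8^-1 (r / 4) <= r / 4 by rewrite ge_min lexx orbT.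
  lra.
Qed.

End GridFloorplan.

(** * Runs free of obstacles on a line *)

Definition run_end (Q : pred nat) (N y : nat) : nat :=
  (y + find Q (iota y (N - y)))%N.

Lemma run_end_ge Q N y : (y <= run_end Q N y)%N.
Proof. exact: leq_addr. Qed.

Lemma run_end_le Q N y : (y <= N)%N -> (run_end Q N y <= N)%N.
Proof.
by move=> yN; have := find_size Q (iota y (N - y)); rewrite size_iota /run_end; lia.
Qed.

Lemma run_end_before Q N y k : (y <= k < run_end Q N y)%N -> ~~ Q k.
Proof.
rewrite /run_end => /andP[yk kr]; have kf : (k - y < find Q (iota y (N - y)))%N by lia.
have := before_find 0%N kf; rewrite nth_iota ?subnKC // => [->//|].
by have := find_size Q (iota y (N - y)); rewrite size_iota; lia.
Qed.

Lemma run_end_stop Q N y : (run_end Q N y < N)%N -> Q (run_end Q N y).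
Proof.
rewrite /run_end => rN; have fs : (find Q (iota y (N - y)) < N - y)%N by lia.
have hQ : has Q (iota y (N - y)) by rewrite has_find size_iota.
by have := nth_find 0%N hQ; rewrite nth_iota.
Qed.

Lemma run_end_gt Q N y : (y < N)%N -> ~~ Q y -> (y < run_end Q N y)%N.
Proof.
move=> yN Qy; have := run_end_ge Q N y; rewrite leq_eqVlt => /orP[/eqP E|//].
by have := @run_end_stop Q N y; rewrite -E yN (negbTE Qy) => /(_ isT).
Qed.

Lemma run_end_unique Q N y b : (y <= b)%N -> (b < N)%N ->
  (forall k, (y <= k < b)%N -> ~~ Q k) -> Q b -> run_end Q N y = b.
Proof.
move=> yb bN nQ Qb; apply/eqP; case: ltngtP => // rb.
  have rN := ltn_trans rb bN; have := nQ (run_end Q N y).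
  by rewrite rb run_end_ge (run_end_stop rN) => /(_ isT).
by have := @run_end_before Q N y b; rewrite yb rb Qb => /(_ isT).
Qed.

Lemma run_end_full Q N y : (y <= N)%N -> (forall k, ~~ Q k) -> run_end Q N y = N.
Proof.
move=> yN nQ; apply/eqP; rewrite eqn_leq run_end_le //= leqNgt.
by apply/negP => /run_end_stop; apply/negP.
Qed.

Section Lines.
Context {S : finType} (f g : S -> nat) (N M : nat).
Hypothesis fg_inj : forall s t, f s = f t -> g s = g t -> s = t.
Hypothesis f_lt : forall s, (f s < N)%N.
Hypothesis g_lt : forall s, ((g s).+1 < M)%N.
Hypothesis g_odd : forall s, odd (g s).

Definition occ (x y : nat) : bool := [exists s, (f s == x) && (g s == y)].

Lemma occP x y : reflect (exists s, f s = x /\ g s = y) (occ x y).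
Proof.
apply: (iffP existsP) => [[s /andP[/eqP <- /eqP <-]]|[s [<- <-]]]; exists s => //.
by rewrite !eqxx.
Qed.

(* The maximal unoccupied runs of the lines: one after each obstacle s and one
   at the beginning of each line. *)
Definition piece := (S + 'I_N)%type.

Definition piece_line (t : piece) : nat :=
  match t with inl s => f s | inr x => x end.

Definition piece_start (t : piece) : nat :=
  match t with inl s => (g s).+1 | inr _ => 0 end.

(** When no obstacle follows, [find] returns the length of the list, and the piece ends at the
    border [M]. *)
Definition piece_end (t : piece) : nat :=
  run_end (occ (piece_line t)) M (piece_start t).

Definition in_piece (t : piece) (x y : nat) : bool :=
  (piece_line t == x) && (piece_start t <= y < piece_end t)%N.

Lemma occ_odd x y : occ x y -> odd y.
Proof. by case/occP => s [_ <-]. Qed.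

Lemma piece_line_lt t : (piece_line t < N)%N.
Proof. by case: t => [s|x] /=. Qed.

(** Obstacles sit at odd positions, so that the even position where a piece starts is free and the
    piece is not empty. *)
Lemma piece_bounds t : (0 < M)%N -> (piece_start t < piece_end t <= M)%N.
Proof.
move=> M0; have sM : (piece_start t < M)%N by case: t.
apply/andP; split; last exact/run_end_le/ltnW.
apply: run_end_gt => //; apply/negP => /occ_odd.
by case: t {sM} => //= s; rewrite g_odd.
Qed.

Lemma piece_not_occ t x y : in_piece t x y -> ~~ occ x y.
Proof. by move=> /andP[/eqP <-]; apply: run_end_before. Qed.

(** A piece can only end at [y.+1] if [y.+1] is occupied, and only start there if [y] is. *)
Lemma piece_step t x y : ~~ occ x y -> ~~ occ x y.+1 -> (y.+1 < M)%N ->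
  in_piece t x y = in_piece t x y.+1.
Proof.
move=> o1 o2 yM; rewrite /in_piece; have [E|//] := eqVneq (piece_line t) x.
rewrite !andTb; apply/andP/andP => -[sy ye]; split; try lia.
  rewrite ltn_neqAle ye andbT; apply: contra o2 => /eqP E2; rewrite E2 -E.
  by apply: run_end_stop; rewrite /piece_end in E2; rewrite -E2.
move: sy; rewrite leq_eqVlt => /orP[/eqP sE|//]; case/negP: o1.
by move: sE E; rewrite /piece_start; case: t {ye} => //= s [<-] <-; apply/occP; exists s.
Qed.

Lemma piece_exists x y : (x < N)%N -> (y < M)%N -> ~~ occ x y ->
  exists t, in_piece t x y.
Proof.
move=> xN; elim: y => [|y IH] yM oy.
  by exists (inr (Ordinal xN)); rewrite /in_piece eqxx /=; apply: run_end_gt.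
case: (boolP (occ x y)) => [/occP[s [fs gs]]|oy']; last first.
  by have [t ty] := IH (ltnW yM) oy'; exists t; rewrite -piece_step.
exists (inl s); rewrite /in_piece /= fs eqxx gs leqnn /piece_end /= fs gs.
exact: run_end_gt.
Qed.

Lemma piece_unique t t' x y : in_piece t x y -> in_piece t' x y -> t = t'.
Proof.
wlog st : t t' / (piece_start t <= piece_start t')%N.
  by move=> W a b; have /orP[] := leq_total (piece_start t) (piece_start t') => ?;
    [|apply/esym]; exact: W.
move=> /andP[/eqP E /andP[s1 e1]] /andP[/eqP E' /andP[s2 e2]].
move: st; rewrite leq_eqVlt => /orP[/eqP st|st].
  move: E E' st; rewrite /piece_line /piece_start.
  case: t {s1 e1} => [s|a]; case: t' {s2 e2} => [s'|b] // <-.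
    by move=> ff [gg]; rewrite (fg_inj _ gg).
  by move=> /val_inj ->.
(* A later start on the same line comes right after an obstacle, which would then lie inside the
   piece [t]. *)
have : exists2 k, (piece_start t <= k < piece_end t)%N & occ x k.
  case: t' st E' {e2} s2 => //= s' st E' s2; exists (g s'); first by lia.
  by apply/occP; exists s'.
by case=> k kt; rewrite -E => ok; have := run_end_before kt; rewrite ok.
Qed.

End Lines.

(** * Rigidity of the walls between two layers of crossing lines *)

Section RigidLines.
Context {T I : Type} (L H : nat) (occ : nat -> nat -> bool).
(** Layer [true] is made of lines along the second coordinate, layer [false] of lines along the
    first. This is kept abstract to serve both horizontal directions, with coordinates and layers
    exchanged. *)
Context (owns : I -> nat -> nat -> bool -> Prop).
Hypothesis owns_unique : forall i j x y k, owns i x y k -> owns j x y k -> i = j.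
Hypothesis owns_exists : forall x y k, (x < L)%N -> (y < H)%N ->
  exists i, owns i x y k.
Hypothesis occ_odd : forall x y, occ x y -> odd x /\ odd y.
Hypothesis occ_layers : forall i x y k k', occ x y -> owns i x y k -> owns i x y k'.
Hypothesis own_step : forall i x y, ~~ occ x y -> ~~ occ x y.+1 -> (y.+1 < H)%N ->
  owns i x y true <-> owns i x y.+1 true.
Hypothesis other_step : forall i x y, ~~ occ x y -> ~~ occ x.+1 y -> (x.+1 < L)%N ->
  owns i x y false <-> owns i x.+1 y false.

Definition close (y q : nat) : bool := [&& q <= y, y <= q.+1 & q < H]%N.

Section Across.
Hypothesis own_wall : forall i j x y,
  owns i x y true -> owns j x.+1 y true -> i <> j.
Context (u w : I -> T) (x y : nat) (A : bool -> Prop).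
Hypothesis xL : (x.+1 < L)%N.
Hypothesis contact : forall q k i j, A k -> close y q ->
  owns i x q k -> owns j x.+1 q k -> i <> j -> u i = w j.

(** One of the lines [x] and [x.+1] is even, hence free of obstacles, and a single block of it
    borders both walls. *)
Let own_rigid q q' i j i' j' : A true -> close y q -> close y q' ->
  owns i x q true -> owns j x.+1 q true ->
  owns i' x q' true -> owns j' x.+1 q' true -> u i = u i'.
Proof.
move=> At.
wlog qq : q q' i j i' j' / (q <= q')%N.
  move=> W c c' a b a' b'; case: (leqP q q') => qq; first exact: (W _ _ _ _ _ _ qq c c' a b a' b').
  exact/esym/(W _ _ _ _ _ _ (ltnW qq) c' c a' b' a b).
move=> c c' a b a' b'; move: qq; rewrite leq_eqVlt => /orP[/eqP qq|qq].
  by rewrite -qq in a' b'; rewrite (owns_unique a a').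
have E : q' = q.+1 by move: c c'; rewrite /close; lia.
have qH : (q.+1 < H)%N by move: c'; rewrite /close; lia.
subst q'; have [ox|ex] := boolP (odd x).
  have nx z : ~~ occ x.+1 z by apply/negP => /occ_odd [/=]; rewrite ox.
  have b1 := (own_step j (nx _) (nx _) qH).1 b.
  have jj := owns_unique b1 b'; subst j'.
  rewrite (contact At c a b); last exact: own_wall a b.
  by rewrite (contact At c' a' b') //; exact: own_wall a' b'.
have nx z : ~~ occ x z by apply/negP => /occ_odd [/=]; rewrite (negbTE ex).
by move: a => /(own_step _ (nx _) (nx _) qH) a; rewrite (owns_unique a a').
Qed.

(** A line of layer [false] runs on from [x] to [x.+1] unless an obstacle interrupts it. *)
Let other_occ q i j : owns i x q false -> owns j x.+1 q false -> i <> j ->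
  occ x q || occ x.+1 q.
Proof.
move=> a b ij; apply/negPn; rewrite negb_or; apply/negP => /andP[n1 n2].
by apply: ij; move/(other_step _ n1 n2 xL): a => a; exact: owns_unique a b.
Qed.

(** The obstacle that creates a wall in layer [false] fills both layers, so that it also borders the
    wall of layer [true] at the same place. *)
Let other_to_own q i j : A true -> A false -> close y q ->
  owns i x q false -> owns j x.+1 q false -> i <> j ->
  exists i' j', [/\ owns i' x q true, owns j' x.+1 q true & u i = u i'].
Proof.
move=> At Af c a b ij; have qH : (q < H)%N by move: c; rewrite /close; lia.
have [i' a'] := owns_exists true (ltnW xL) qH.
have [j' b'] := owns_exists true xL qH.
exists i', j'; split=> //; case/orP: (other_occ a b ij) => o.
  by rewrite (owns_unique (occ_layers true o a) a').
rewrite (contact Af c a b ij) (owns_unique (occ_layers true o b) b').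
by rewrite (contact At c a' b') //; exact: own_wall a' b'.
Qed.

(** A wall of layer [false] is compared with one of layer [true] by first passing to layer [true].
    The predicate [A] selects the layers that touch the corner: only one of them on the bottom or
    the top of the host. *)
Lemma rigid_across q k i j q' k' i' j' : A k -> A k' ->
  close y q -> close y q' -> owns i x q k -> owns j x.+1 q k -> i <> j ->
  owns i' x q' k' -> owns j' x.+1 q' k' -> i' <> j' -> u i = u i'.
Proof.
case: k; case: k' => ak ak' c c' a b ij a' b' ij'.
- exact: own_rigid a b a' b'.
- have [i1 [j1 [a1 b1 ->]]] := other_to_own ak ak' c' a' b' ij'.
  exact: own_rigid a b a1 b1.
- have [i1 [j1 [a1 b1 ->]]] := other_to_own ak' ak c a b ij.
  exact: own_rigid a1 b1 a' b'.
(* Two walls of layer [false] both come from obstacles, at positions that are odd and close, hence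
   equal. *)
have oq : odd q by case/orP: (other_occ a b ij) => /occ_odd [].
have oq' : odd q' by case/orP: (other_occ a' b' ij') => /occ_odd [].
have E : q = q' by move: c c'; rewrite /close; lia.
by subst q'; rewrite (owns_unique a a').
Qed.

End Across.

Definition close2 (x y p q : nat) : bool :=
  [&& p <= x, x <= p.+1, p < L & close y q]%N.

Hypothesis free_layers : forall i j x y, ~~ occ x y ->
  owns i x y true -> owns j x y false -> i <> j.

(* At most one of the four cells around (x, y) is occupied, and the others are
   linked through the long pieces of one layer or of the other. *)
Lemma rigid_vertical (u w : I -> T) x y :
  (forall p q i j, close2 x y p q -> owns i p q true -> owns j p q false ->
    i <> j -> u i = w j) ->
  forall p q i j p' q' i' j', close2 x y p q -> close2 x y p' q' ->
    owns i p q true -> owns j p q false -> i <> j ->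
    owns i' p' q' true -> owns j' p' q' false -> i' <> j' -> u i = u i'.
Proof.
move=> contact.
have free p q i j : owns i p q true -> owns j p q false -> i <> j -> ~~ occ p q.
  move=> a b ij; apply/negP => o; apply: ij.
  exact: owns_unique (occ_layers false o a) b.
have same_x p q q' i i' : close2 x y p q -> close2 x y p q' -> (q <= q')%N ->
    ~~ occ p q -> ~~ occ p q' -> owns i p q true -> owns i' p q' true -> u i = u i'.
  move=> c c'; rewrite leq_eqVlt => /orP[/eqP <- _ _ a a'|qq n n' a a'].
    by rewrite (owns_unique a a').
  have E : q' = q.+1 by move: c c'; rewrite /close2 /close; lia.
  have qH : (q.+1 < H)%N by move: c'; rewrite /close2 /close; lia.
  by subst q'; move/(own_step _ n n' qH): a => a; rewrite (owns_unique a a').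
have same_y p p' q i i' : close2 x y p q -> close2 x y p' q -> (p <= p')%N ->
    ~~ occ p q -> ~~ occ p' q -> owns i p q true -> owns i' p' q true -> u i = u i'.
  move=> c c'; rewrite leq_eqVlt => /orP[/eqP <- _ _ a a'|qq n n' a a'].
    by rewrite (owns_unique a a').
  have E : p' = p.+1 by move: c c'; rewrite /close2 /close; lia.
  have pL : (p.+1 < L)%N by move: c'; rewrite /close2 /close; lia.
  have qH : (q < H)%N by move: c'; rewrite /close2 /close; lia.
  (* A single block [j] of layer [false] covers both cells and is in contact with the two blocks of
     layer [true]. *)
  subst p'; have [j b] := owns_exists false (ltnW pL) qH.
  have b' : owns j p.+1 q false by apply/(other_step _ n n' pL).
  rewrite (contact _ _ _ _ c a b (free_layers n a b)).
  by rewrite (contact _ _ _ _ c' a' b' (free_layers n' a' b')).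
have {}same_x p q q' i i' : close2 x y p q -> close2 x y p q' ->
    ~~ occ p q -> ~~ occ p q' -> owns i p q true -> owns i' p q' true -> u i = u i'.
  move=> c c' n n' a a'; case: (leqP q q') => qq; first exact: (same_x _ _ _ _ _ c c' qq n n' a a').
  exact/esym/(same_x _ _ _ _ _ c' c (ltnW qq) n' n a' a).
have {}same_y p p' q i i' : close2 x y p q -> close2 x y p' q ->
    ~~ occ p q -> ~~ occ p' q -> owns i p q true -> owns i' p' q true -> u i = u i'.
  move=> c c' n n' a a'; case: (leqP p p') => qq; first exact: (same_y _ _ _ _ _ c c' qq n n' a a').
  exact/esym/(same_y _ _ _ _ _ c' c (ltnW qq) n' n a' a).
move=> p q i j p' q' i' j' c c' a b ij a' b' ij'.
have n := free _ _ _ _ a b ij; have n' := free _ _ _ _ a' b' ij'.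
have [pp|pp] := eqVneq p p'.
  by subst p'; exact: (same_x _ _ _ _ _ c c' n n' a a').
have cc : close2 x y p q' by move: c c'; rewrite /close2 /close; lia.
have cc' : close2 x y p' q by move: c c'; rewrite /close2 /close; lia.
(* The link goes through the cell [(p, q')] or [(p', q)]. They are not both occupied: [p] and [p']
   are consecutive, and occupied cells have odd coordinates. *)
case: (boolP (occ p q')) => o; last first.
  have [k d] : exists k, owns k p q' true.
    by apply: owns_exists; move: cc; rewrite /close2 /close; lia.
  by rewrite (same_x _ _ _ _ _ c cc n o a d); exact: (same_y _ _ _ _ _ cc c' o n' d a').
have o' : ~~ occ p' q.
  apply/negP => /occ_odd[op' _]; have [op _] := occ_odd o.
  by move: c c' pp; rewrite /close2 /close; lia.
have [k d] : exists k, owns k p' q true.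
  by apply: owns_exists; move: cc'; rewrite /close2 /close; lia.
by rewrite (same_y _ _ _ _ _ c cc' n o' a d); exact: (same_x _ _ _ _ _ cc' c' o' n' d a').
Qed.

End RigidLines.

(** * Floor plans built from pillars *)

Definition xdir : 'I_3 := ord0.
Definition ydir : 'I_3 := @Ordinal 3 1 isT.

Definition vec3 (x y z : nat) : cell := fun d => nth 0%N [:: x; y; z] d.

Lemma forall_dir (A : 'I_3 -> Prop) : A xdir -> A ydir -> A zdir -> forall d, A d.
Proof.
move=> Ax Ay Az [[|[|[|//]]] lt_d3].
- by rewrite (_ : Ordinal _ = xdir) //; apply: val_inj.
- by rewrite (_ : Ordinal _ = ydir) //; apply: val_inj.
- by rewrite (_ : Ordinal _ = zdir) //; apply: val_inj.
Qed.

Section Pillars.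
Context {R : realType} {S : finType} (px py : S -> nat) (L H : nat).

(* A pillar, a bottom piece (a run of a column) or a top piece (a run of a row). *)
Definition label := (S + @piece S L + @piece S H)%type.

Definition label_lo (b : label) : cell := match b with
  | inl (inl s) => vec3 (px s) (py s) 0
  | inl (inr t) => vec3 (piece_line px t) (piece_start py t) 0
  | inr t => vec3 (piece_start px t) (piece_line py t) 1
  end.

Definition label_hi (b : label) : cell := match b with
  | inl (inl s) => vec3 (px s).+1 (py s).+1 2
  | inl (inr t) => vec3 (piece_line px t).+1 (piece_end px py H t) 1
  | inr t => vec3 (piece_end py px L t) (piece_line py t).+1 2
  end.

Definition in_label (b : label) (x y z : nat) : bool := match b with
  | inl (inl s) => [&& px s == x, py s == y & z < 2]%N
  | inl (inr t) => in_piece px py H t x y && (z == 0)%N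
  | inr t => in_piece py px L t y x && (z == 1)%N
  end.

Lemma in_labelP b c : in_cells (label_lo b) (label_hi b) c <->
  in_label b (c xdir) (c ydir) (c zdir).
Proof.
split=> [cb|].
  have := cb xdir; have := cb ydir; have := cb zdir.
  by case: b cb => [[s|t]|t] _; rewrite /= /vec3 /= /in_piece; lia.
by case: b => [[s|t]|t]; rewrite /= /in_piece => cb; apply: forall_dir;
  rewrite /= /vec3 /=; lia.
Qed.

Hypothesis pos_inj : forall s t, px s = px t -> py s = py t -> s = t.
Hypothesis px_odd : forall s, odd (px s).
Hypothesis py_odd : forall s, odd (py s).
Hypothesis px_lt : forall s, ((px s).+1 < L)%N.
Hypothesis py_lt : forall s, ((py s).+1 < H)%N.
Hypothesis L_gt0 : (0 < L)%N.
Hypothesis H_gt0 : (0 < H)%N.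

Let pos_inj' s t : py s = py t -> px s = px t -> s = t.
Proof. by move=> *; apply: pos_inj. Qed.
Let px_ltW s : (px s < L)%N. Proof. exact: ltnW. Qed.
Let py_ltW s : (py s < H)%N. Proof. exact: ltnW. Qed.

Lemma occ_sym x y : occ py px y x = occ px py x y.
Proof. by apply/occP/occP => -[s [? ?]]; exists s. Qed.

Lemma occ_both_odd x y : occ px py x y -> odd x /\ odd y.
Proof. by case/occP => s [<- <-]. Qed.

Definition dims : cell := vec3 L H 2.

Lemma label_bounds b d : (label_lo b d < label_hi b d <= dims d)%N.
Proof.
move: d; apply: forall_dir; case: b => [[s|t]|t] //=; rewrite /vec3 /=.
- by rewrite ltnS leqnn ltnW.
- by rewrite ltnS leqnn piece_line_lt.
- exact: piece_bounds.
- by rewrite ltnS leqnn ltnW.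
- exact: piece_bounds.
- by rewrite ltnS leqnn piece_line_lt.
Qed.

Lemma in_label_exists x y z : (x < L)%N -> (y < H)%N -> (z < 2)%N ->
  exists b, in_label b x y z.
Proof.
move=> xL yH z2; case: (boolP (occ px py x y)) => [/occP[s [xs ys]]|no].
  by exists (inl (inl s)); rewrite /= xs ys !eqxx.
case: z z2 => [|[|//]] _.
  have [t tP] := piece_exists xL yH no.
  by exists (inl (inr t)); rewrite /= tP.
rewrite -occ_sym in no; have [t tP] := piece_exists yH xL no.
by exists (inr t); rewrite /= tP.
Qed.

Lemma in_label_pillar s b x y z : px s = x -> py s = y -> in_label b x y z ->
  b = inl (inl s).
Proof.
move=> <- <-; have o : occ px py (px s) (py s) by apply/occP; exists s.
case: b => [[s'|t]|t] /=.
- by move=> /and3P[/eqP xx /eqP yy _]; rewrite (pos_inj xx yy).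
- by case/andP => /piece_not_occ; rewrite o.
- by case/andP => /piece_not_occ; rewrite occ_sym o.
Qed.

Lemma in_label_unique b b' x y z : in_label b x y z -> in_label b' x y z -> b = b'.
Proof.
move=> bP b'P; case: (boolP (occ px py x y)) => [/occP[s [xs ys]]|no].
  by rewrite (in_label_pillar xs ys bP) (in_label_pillar xs ys b'P).
have np s : ~~ [&& px s == x, py s == y & z < 2]%N.
  apply: contra no => /and3P[/eqP xs /eqP ys _]; apply/occP; by exists s.
case: b bP => [[s|t]|t] /=; first by rewrite (negbTE (np s)).
  case: b' b'P => [[s|t']|t'] /=; first by rewrite (negbTE (np s)).
    by case/andP=> a _ /andP[a' _]; rewrite (piece_unique pos_inj a a').
  by case/andP=> a /eqP -> /andP[].
case: b' b'P => [[s|t']|t'] /=; first by rewrite (negbTE (np s)).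
  by case/andP=> a /eqP -> /andP[].
by case/andP=> a _ /andP[a' _]; rewrite (piece_unique pos_inj' a a').
Qed.

Section Indexed.
Context {n : nat} (idx : 'I_n -> label).
Hypothesis idx_bij : bijective idx.

Let blk_lo i := label_lo (idx i).
Let blk_hi i := label_hi (idx i).

Lemma pillar_tiling : grid_tiling dims blk_lo blk_hi.
Proof.
split=> [i d|c cD|c i j /in_labelP ic /in_labelP jc]; first exact: label_bounds.
  have [b bP] := in_label_exists (cD xdir) (cD ydir) (cD zdir).
  by have [f idxK fK] := idx_bij; exists (f b); apply/in_labelP; rewrite fK.
exact/(bij_inj idx_bij)/in_label_unique/jc.
Qed.

Lemma dims_gt0 d : (0 < dims d)%N.
Proof. by move: d; apply: forall_dir. Qed.

Lemma low_wall i j x y :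
  in_label (idx i) x y 0 -> in_label (idx j) x.+1 y 0 -> i <> j.
Proof.
move=> + + ij; rewrite -{}ij; case: (idx i) => [[s|t]|t] /=; rewrite ?andbF //.
  by lia.
by rewrite /in_piece; lia.
Qed.

Lemma high_wall i j x y :
  in_label (idx i) x y 1 -> in_label (idx j) x y.+1 1 -> i <> j.
Proof.
move=> + + ij; rewrite -{}ij; case: (idx i) => [[s|t]|t] /=; rewrite ?andbF //.
  by lia.
by rewrite /in_piece; lia.
Qed.

Lemma low_step b x y : ~~ occ px py x y -> ~~ occ px py x y.+1 -> (y.+1 < H)%N ->
  in_label b x y 0 = in_label b x y.+1 0.
Proof.
move=> o o' yH; case: b => [[s|t]|t] /=; last by rewrite !andbF.
  have np y' : ~~ occ px py x y' -> (px s == x) && (py s == y') = false.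
    by move=> /negP no; apply/negP => /andP[/eqP xs /eqP ys]; apply/no/occP; exists s.
  by rewrite !andbT !np.
by rewrite !andbT; apply: piece_step.
Qed.

Lemma high_step b x y : ~~ occ px py x y -> ~~ occ px py x.+1 y -> (x.+1 < L)%N ->
  in_label b x y 1 = in_label b x.+1 y 1.
Proof.
move=> o o' xL; case: b => [[s|t]|t] /=; last first.
- by rewrite !andbT; apply: piece_step => //; rewrite occ_sym.
- by rewrite !andbF.
have np x' : ~~ occ px py x' y -> (px s == x') && (py s == y) = false.
  by move=> /negP no; apply/negP => /andP[/eqP xs /eqP ys]; apply/no/occP; exists s.
by rewrite !andbT !np.
Qed.

Lemma pillar_layers b x y z z' : (z' < 2)%N -> occ px py x y ->
  in_label b x y z -> in_label b x y z'.
Proof.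
by move=> z2 /occP[s [xs ys]] /(in_label_pillar xs ys) ->; rewrite /= xs ys !eqxx.
Qed.

Lemma free_wall i j x y : ~~ occ px py x y ->
  in_label (idx i) x y 0 -> in_label (idx j) x y 1 -> i <> j.
Proof.
move=> /negP no + + ij; rewrite -{}ij; case: (idx i) => [[s|t]|t] /=; rewrite ?andbF //.
by move=> /and3P[/eqP xs /eqP ys _] _; apply/no/occP; exists s.
Qed.

Let owns_exists x y z : (x < L)%N -> (y < H)%N -> (z < 2)%N ->
  exists i, in_label (idx i) x y z.
Proof.
move=> xL yH z2; have [b bP] := in_label_exists xL yH z2.
by have [f _ fK] := idx_bij; exists (f b); rewrite fK.
Qed.

Let owns_unique i j x y z : in_label (idx i) x y z -> in_label (idx j) x y z -> i = j.
Proof. by move=> a b; apply/(bij_inj idx_bij)/in_label_unique/b. Qed.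

Lemma wall_in_label P d c i j : wall dims blk_lo blk_hi P d c i j ->
  let a := subst_coord c d (P d).-1 in let b := subst_coord c d (P d) in
  [/\ forall k, k != d -> [&& c k <= P k, P k <= (c k).+1 & c k < dims k]%N,
      in_label (idx i) (a xdir) (a ydir) (a zdir),
      in_label (idx j) (b xdir) (b ydir) (b zdir) & i <> j].
Proof. by case=> q /in_labelP ic /in_labelP jc ij. Qed.

Lemma layer_cases z : (z < 2)%N -> exists k : bool, z = ~~ k.
Proof. by case: z => [|[|//]] _; [exists true|exists false]. Qed.

Lemma xwall_in_label P c i j : (0 < P xdir)%N ->
  wall dims blk_lo blk_hi P xdir c i j -> exists q (k : bool),
  [/\ close H (P ydir) q, (~~ k <= P zdir <= (~~ k).+1)%N,
      in_label (idx i) (P xdir).-1 q (~~ k),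
      in_label (idx j) (P xdir).-1.+1 q (~~ k) & i <> j].
Proof.
move=> P0 /wall_in_label[qc ic jc ij].
have /and3P[z1 z2 z3] := qc zdir isT; have y1 := qc ydir isT.
have [k kE] := layer_cases z3; exists (c ydir), k; split=> //.
- by rewrite -kE z1 z2.
- by rewrite -kE; exact: ic.
- by rewrite -kE prednK; [exact: jc|].
Qed.

Lemma ywall_in_label P c i j : (0 < P ydir)%N ->
  wall dims blk_lo blk_hi P ydir c i j -> exists q (k : bool),
  [/\ close L (P xdir) q, (k <= P zdir <= k.+1)%N,
      in_label (idx i) q (P ydir).-1 k,
      in_label (idx j) q (P ydir).-1.+1 k & i <> j].
Proof.
move=> P0 /wall_in_label[qc ic jc ij].
have /and3P[z1 z2 z3] := qc zdir isT; have x1 := qc xdir isT.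
have [k kE] := layer_cases z3; exists (c xdir), (~~ k); split=> //.
- by rewrite -kE z1 z2.
- by rewrite -kE; exact: ic.
- by rewrite -kE prednK; [exact: jc|].
Qed.

Lemma zwall_in_label P c i j : P zdir = 1%N ->
  wall dims blk_lo blk_hi P zdir c i j -> exists p q,
  [/\ close2 L H (P xdir) (P ydir) p q,
      in_label (idx i) p q 0, in_label (idx j) p q 1 & i <> j].
Proof.
move=> P1 /wall_in_label[qc ic jc ij].
have /and3P[x1 x2 x3] := qc xdir isT; have y1 := qc ydir isT.
exists (c xdir), (c ydir); split=> //; first by rewrite /close2 x1 x2 x3.
  by rewrite P1 in ic; exact: ic.
by rewrite P1 in jc; exact: jc.
Qed.

Lemma label_wall P d c i j : (forall k, k != d ->
    [&& c k <= P k, P k <= (c k).+1 & c k < dims k]%N) ->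
  let a := subst_coord c d (P d).-1 in let b := subst_coord c d (P d) in
  in_label (idx i) (a xdir) (a ydir) (a zdir) ->
  in_label (idx j) (b xdir) (b ydir) (b zdir) -> i <> j ->
  wall dims blk_lo blk_hi P d c i j.
Proof. by move=> qc a b ia jb ij; split=> //; apply/in_labelP. Qed.

(** In the x-direction layer [true] is the bottom one, made of columns; in the y-direction it is the
    top one, made of rows. In the z-direction the only interior plane is the one between the
    layers. *)
Lemma pillar_rigid : rigid_walls R dims blk_lo blk_hi.
Proof.
move=> P d Pd u w; move: d Pd; apply: forall_dir => Pd contact c i j c' i' j'.
- have P0 : (0 < P xdir)%N by case/andP: Pd.
  move=> /(xwall_in_label P0)[q [k [cq kz ic jc ij]]].
  move=> /(xwall_in_label P0)[q' [k' [cq' kz' ic' jc' ij']]].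
  apply: (@rigid_across R 'I_n L H (occ px py)
    (fun i x y k => in_label (idx i) x y (~~ k)) _ _ _ _ _ _ _ u w
    (P xdir).-1 (P ydir) (fun k => (~~ k <= P zdir <= (~~ k).+1)%N) _ _
    q k i j q' k' i' j') => //.
  + by move=> *; apply: owns_unique; eassumption.
  + by move=> x y [] xL yH; apply: owns_exists.
  + exact: occ_both_odd.
  + by move=> ? ? ? ? []; apply: pillar_layers.
  + by move=> ? ? ? *; rewrite /= low_step.
  + by move=> ? ? ? *; rewrite /= high_step.
  + by move=> ? ? ? ?; apply: low_wall.
  + by rewrite prednK //; case/andP: Pd.
  + move=> r l a b kk cr ir jr ab.
    apply: (contact (vec3 0 r (~~ l)) a b); apply: label_wall => //.
    * by apply: forall_dir => // _; move: cr kk; rewrite /dims /vec3 /close /=; case: (l) => /=; lia.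
    * by move: jr; rewrite /= prednK.
- have P0 : (0 < P ydir)%N by case/andP: Pd.
  move=> /(ywall_in_label P0)[q [k [cq kz ic jc ij]]].
  move=> /(ywall_in_label P0)[q' [k' [cq' kz' ic' jc' ij']]].
  apply: (@rigid_across R 'I_n H L (fun y x => occ px py x y)
    (fun i y x k => in_label (idx i) x y k) _ _ _ _ _ _ _ u w
    (P ydir).-1 (P xdir) (fun k => (k <= P zdir <= k.+1)%N) _ _
    q k i j q' k' i' j') => //.
  + by move=> *; apply: owns_unique; eassumption.
  + by move=> x y [] xL yH; apply: owns_exists.
  + by move=> ? ? /occ_both_odd[].
  + by move=> ? ? ? ? []; apply: pillar_layers.
  + by move=> ? ? ? *; rewrite /= high_step.
  + by move=> ? ? ? *; rewrite /= low_step.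
  + by move=> ? ? ? ?; apply: high_wall.
  + by rewrite prednK //; case/andP: Pd.
  + move=> r l a b kk cr ir jr ab.
    apply: (contact (vec3 r 0 l) a b); apply: label_wall => //.
    * by apply: forall_dir => // _; move: cr kk; rewrite /dims /vec3 /close /=; case: (l) => /=; lia.
    * by move: jr; rewrite /= prednK.
have P1 : P zdir = 1%N by move: Pd; rewrite /dims /vec3 /=; lia.
move=> /(zwall_in_label P1)[p [q [cq ic jc ij]]].
move=> /(zwall_in_label P1)[p' [q' [cq' ic' jc' ij']]].
apply: (@rigid_vertical R 'I_n L H (occ px py)
  (fun i x y k => in_label (idx i) x y (~~ k)) _ _ _ _ _ _ _ u w
  (P xdir) (P ydir) _ p q i j p' q' i' j') => //.
- by move=> *; apply: owns_unique; eassumption.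
- by move=> x y [] xL yH; apply: owns_exists.
- exact: occ_both_odd.
- by move=> ? ? ? ? []; apply: pillar_layers.
- by move=> ? ? ? *; rewrite /= low_step.
- by move=> ? ? ? *; rewrite /= high_step.
- by move=> ? ? ? ?; apply: free_wall.
move=> r r' a b /and4P[r1 r2 r3 r4] ir jr ab.
apply: (contact (vec3 r r' 0) a b); apply: label_wall => //.
- by apply: forall_dir => //= _; rewrite ?r1 ?r2.
- by move: ir; rewrite /= P1.
- by move: jr; rewrite /= P1.
Qed.

Definition pillar_floorplan : floorplan R n :=
  grid_floorplan dims_gt0 pillar_tiling.

Lemma pillar_generic_two_layer : generic_two_layer pillar_floorplan.
Proof.
split; last exact/grid_generic/pillar_rigid.
exists 1; split=> [|i /=]; first by rewrite ltr01 ltr1n.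
by rewrite /blk_lo /blk_hi; case: (idx i) => [[s|t]|t];
  [constructor 3|constructor 1|constructor 2].
Qed.

End Indexed.
End Pillars.

(** * Dissection graphs and the recovery of coordinates *)

Lemma attached_sym (R : realType) (n : nat) (F : floorplan R n) d :
  symmetric (attached F d).
Proof.
move=> f g; rewrite /attached /= /overlap_area eq_sym.
by under eq_bigr do rewrite minC [X in _ - X]maxC.
Qed.

Lemma connect_coord (R : realType) (n : nat) (F : floorplan R n) d f g :
  connect (attached F d) f g -> face_coord F d f = face_coord F d g.
Proof.
case/connectP => p + ->; elim: p f => //= h p IH f /andP[fh hp].
rewrite -(IH _ hp); move: fh; rewrite /attached /= /overlap_area.
by case: eqP => //; rewrite ltxx.
Qed.

Lemma plane_coord (R : realType) (n : nat) (F : floorplan R n) d f g :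
  plane F d f = plane F d g -> face_coord F d f = face_coord F d g.
Proof.
move=> /(congr1 val) /= /setP/(_ g); rewrite !inE connect0 => fg.
exact: connect_coord.
Qed.

Lemma connect_plane (R : realType) (n : nat) (F : floorplan R n) d f g :
  connect (attached F d) f g -> plane F d f = plane F d g.
Proof.
move=> fg; apply: val_inj; apply/setP => k /=; rewrite !inE.
by apply: same_connect => //; exact/sym_connect_sym/attached_sym.
Qed.

Lemma attachedI (R : realType) (n : nat) (F : floorplan R n) d f g :
  face_coord F d f = face_coord F d g ->
  (forall k, k != d -> lo (block F f.1) k < hi (block F g.1) k /\
     lo (block F g.1) k < hi (block F f.1) k) ->
  attached F d f g.
Proof.
move=> fg over; rewrite /attached /= /overlap_area fg eqxx.
apply: prodr_gt0 => k kd; rewrite lt_max subr_gt0 lt_min !gt_max.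
have [-> ->] := over k kd; rewrite !andbT /=.
by rewrite (block_nondegenerate F f.1 k) (block_nondegenerate F g.1 k) orbT.
Qed.

Section GraphIsomorphism.
Context {R : realType} {n : nat} (F G : floorplan R n) (d : 'I_3) (L : nat).
Context (lF hF lG hG : 'I_n -> nat).
Hypothesis F_lo : forall i, lo (block F i) d = (lF i)%:R.
Hypothesis F_hi : forall i, hi (block F i) d = (hF i)%:R.
Hypothesis G_lo : forall i, lo (block G i) d = (lG i)%:R.
Hypothesis G_hi : forall i, hi (block G i) d = (hG i)%:R.
Hypothesis G_le : forall i, (hG i <= L)%N.
Hypothesis unit_steps : forall x, (x < L)%N -> exists i, lF i = x /\ hF i = x.+1.
Hypothesis one_plane : forall x f g, (0 < x < L)%N ->
  face_coord F d f = x%:R -> face_coord F d g = x%:R -> plane F d f = plane F d g.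

(* The unit steps of F form a directed path of length L; its image in G advances
   by at least one at each step and has only L to go, so that it keeps the
   coordinates, and so do all the planes through which the path goes. *)
Lemma isomorphism_keeps_ranges :
  isomorphic (dissection_graph F d) (dissection_graph G d) ->
  exists psi : 'I_n -> 'I_n, forall i, (0 < lF i)%N -> (hF i < L)%N ->
    lG (psi i) = lF i /\ hG (psi i) = hF i.
Proof.
case=> [phi [psi [_ _ src tgt]]]; exists psi; move: src tgt => /= src tgt.
have lhG i : (lG i < hG i)%N.
  by have := block_nondegenerate G i d; rewrite G_lo G_hi ltr_nat.
have lhF i : (lF i < hF i)%N.
  by have := block_nondegenerate F i d; rewrite F_lo F_hi ltr_nat.
have samelo i j : (0 < lF i < L)%N -> lF i = lF j -> lG (psi i) = lG (psi j).
  move=> iL ij; apply/eqP; rewrite -(eqr_nat R) -!G_lo; apply/eqP.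
  apply: (@plane_coord _ _ _ _ (psi i, false) (psi j, false)).
  by rewrite !src (one_plane (g := (j, false)) iL) // /face_coord /= F_lo ?ij.
have samehi i j : (0 < hF i < L)%N -> hF i = hF j -> hG (psi i) = hG (psi j).
  move=> iL ij; apply/eqP; rewrite -(eqr_nat R) -!G_hi; apply/eqP.
  apply: (@plane_coord _ _ _ _ (psi i, true) (psi j, true)).
  by rewrite !tgt (one_plane (g := (j, true)) iL) // /face_coord /= F_hi ?ij.
have samelohi i j : (0 < hF i < L)%N -> hF i = lF j -> hG (psi i) = lG (psi j).
  move=> iL ij; apply/eqP; rewrite -(eqr_nat R) -G_hi -G_lo; apply/eqP.
  apply: (@plane_coord _ _ _ _ (psi i, true) (psi j, false)).
  by rewrite tgt src (one_plane (g := (j, false)) iL) // /face_coord /= ?F_hi ?F_lo ?ij.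
have up x i : lF i = x -> hF i = x.+1 -> (x < L)%N -> (x <= lG (psi i))%N.
  elim: x i => // x IH i li hi xL; have [j [lj hj]] := unit_steps (ltnW xL).
  have := IH j lj hj (ltnW xL); have := lhG (psi j).
  by rewrite (samelohi j i) ?hj //; lia.
have down x i : lF i = (L - x.+1)%N -> hF i = (L - x.+1).+1 -> (x < L)%N ->
    (hG (psi i) <= L - x)%N.
  elim: x i => [|x IH] i li hi xL; first by rewrite subn0.
  have [|j [lj hj]] := unit_steps (x := (L - x.+1)%N); first by lia.
  have := IH j lj hj (ltnW xL); have := lhG (psi j).
  by rewrite (samelohi i j) ?hi //; lia.
have exact x i : lF i = x -> hF i = x.+1 -> (x < L)%N ->
    lG (psi i) = x /\ hG (psi i) = x.+1.
  move=> li hi xL; have := up x i li hi xL.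
  have := down (L - x.+1)%N i; rewrite li hi.
  have -> : (L - (L - x.+1).+1)%N = x by lia.
  have -> : (L - (L - x.+1))%N = x.+1 by lia.
  by move=> /(_ erefl erefl) + ?; have := lhG (psi i); lia.
(* The extreme coordinates are excluded: a face on the boundary of the host is attached only to
   itself, so that several planes may share such a coordinate. *)
move=> i l0 hL; split.
  have xL : (lF i < L)%N by have := lhF i; lia.
  have [j [lj hj]] := unit_steps xL.
  by rewrite (samelo i j) ?l0 //; have [-> _] := exact _ _ lj hj xL.
have x0 : ((hF i).-1 < L)%N by lia.
have [j [lj hj]] := unit_steps x0.
have hji : hF j = hF i by rewrite hj prednK //; have := lhF i; lia.
rewrite (samehi i j) //; last by have := lhF i; lia.
by have [_ ->] := exact _ _ lj hj x0; rewrite -hj hji.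
Qed.

End GraphIsomorphism.

Definition next_in_row (S : Type) (px py : S -> nat) (s t : S) : Prop :=
  [/\ py s = py t, (px s < px t)%N &
      forall r, py r = py s -> ~~ (px s < px r < px t)%N].

Section PillarGraph.
Context {R : realType} {S : finType} (px py : S -> nat) (L H : nat).
Hypothesis pos_inj : forall s t, px s = px t -> py s = py t -> s = t.
Hypothesis px_odd : forall s, odd (px s).
Hypothesis py_odd : forall s, odd (py s).
Hypothesis px_lt : forall s, ((px s).+1 < L)%N.
Hypothesis py_lt : forall s, ((py s).+1 < H)%N.
Hypothesis L_gt0 : (0 < L)%N.
Hypothesis H_gt0 : (0 < H)%N.
Context {n : nat} (idx : 'I_n -> @label S L H).
Hypothesis idx_bij : bijective idx.

Let F : floorplan R n := pillar_floorplan (R := R) pos_inj px_odd py_odd px_lt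
  py_lt L_gt0 H_gt0 idx_bij.

Lemma pillar_attached f g : face_coord F xdir f = face_coord F xdir g ->
  (forall k, k != xdir ->
    (label_lo px py (idx f.1) k < label_hi px py (idx g.1) k)%N /\
    (label_lo px py (idx g.1) k < label_hi px py (idx f.1) k)%N) ->
  connect (attached F xdir) f g.
Proof.
by move=> fg over; apply/connect1/attachedI => // k /over; rewrite /= !ltr_nat.
Qed.

(** One of the two columns next to [x] is even, hence uncut; its face at [x] is a spine to which the
    faces at [x] of all bottom pieces and pillars are attached. A top piece reaches it through the
    pillar that bounds it. *)
Lemma pillar_one_plane x f g : (0 < x < L)%N ->
  face_coord F xdir f = x%:R -> face_coord F xdir g = x%:R ->
  plane F xdir f = plane F xdir g.
Proof.
move=> xL; have [unidx idxK unidxK] := idx_bij.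
pose e := if odd x then x.-1 else x.
have eL : (e < L)%N by rewrite /e; case: ifP; lia.
have e_even : ~~ odd e by rewrite /e; case: ifP; lia.
(* [odd x] selects the face of column [e] that lies at [x]: the upper one when [e] is [x.-1]. *)
pose spine : face n := (unidx (inl (inr (inr (Ordinal eL)))), odd x).
have spine_coord : face_coord F xdir spine = x%:R.
  rewrite /face_coord /spine /= unidxK /e /=.
  by case: ifP => ox; rewrite /vec3 /= ox ?prednK //; case/andP: xL.
have spine_end : piece_end px py H (inr (Ordinal eL)) = H.
  by apply: run_end_full => // k; apply/negP => /(occ_both_odd px_odd py_odd)[] /=;
    rewrite (negbTE e_even).
have pillar_spine s b : face_coord F xdir (unidx (inl (inl s)), b) = x%:R ->
    connect (attached F xdir) (unidx (inl (inl s)), b) spine.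
  move=> sx; apply: pillar_attached; rewrite ?sx ?spine_coord // => k.
  rewrite /= !unidxK; move: k; apply: forall_dir => // _.
  by rewrite /= /vec3 /= spine_end; have := py_lt s; lia.
have to_spine k : face_coord F xdir k = x%:R -> connect (attached F xdir) k spine.
  case: k => i b; rewrite -(idxK i); case: (idx i) => [[s|t]|t] kx.
  - exact: pillar_spine.
  - apply: pillar_attached; rewrite ?kx ?spine_coord // => k.
    have tb := piece_bounds px py_lt py_odd t H_gt0.
    rewrite /= !unidxK; move: k; apply: forall_dir => // _.
    by rewrite /= /vec3 /= spine_end; lia.
  have step s c : py s = piece_line py t ->
      face_coord F xdir (unidx (inl (inl s)), c) = x%:R ->
      connect (attached F xdir) (unidx (inr t), b) spine.
    move=> st sx; apply: connect_trans (pillar_spine s c sx).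
    apply: pillar_attached; rewrite ?kx ?sx // => k.
    rewrite /= !unidxK; move: k; apply: forall_dir => // _.
    by rewrite /= /vec3 /= st; lia.
  move: kx; rewrite {1}/face_coord /=; case: b step => step; rewrite unidxK /=.
    move=> /eqP; rewrite eqr_nat /vec3 /= => /eqP tx.
    have : occ py px (piece_line py t) x.
      by rewrite -tx; apply: run_end_stop; rewrite -/(piece_end _ _ _ _) tx; case/andP: xL.
    case/occP => s [st sx]; apply: (step s false st).
    by rewrite /face_coord /= unidxK /= sx.
  move=> /eqP; rewrite eqr_nat /vec3 /= => /eqP tx.
  case: t step tx => [s|y] /= step tx; last by move: xL; rewrite -tx.
  by apply: (step s true) => //; rewrite /face_coord /= unidxK /= tx.
move=> fx gx; apply: connect_plane; apply: connect_trans (to_spine _ fx) _.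
by rewrite (sym_connect_sym (attached_sym _ _)); exact: to_spine.
Qed.

End PillarGraph.

Section PillarRecovery.
Context {R : realType} {S : finType} (px py px' py' : S -> nat) (L H : nat).
Hypothesis pos_inj : forall s t, px s = px t -> py s = py t -> s = t.
Hypothesis px_odd : forall s, odd (px s).
Hypothesis py_odd : forall s, odd (py s).
Hypothesis px_lt : forall s, ((px s).+1 < L)%N.
Hypothesis py_lt : forall s, ((py s).+1 < H)%N.
Hypothesis pos_inj' : forall s t, px' s = px' t -> py' s = py' t -> s = t.
Hypothesis px_odd' : forall s, odd (px' s).
Hypothesis py_odd' : forall s, odd (py' s).
Hypothesis px_lt' : forall s, ((px' s).+1 < L)%N.
Hypothesis py_lt' : forall s, ((py' s).+1 < H)%N.
Hypothesis L_gt0 : (0 < L)%N.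
Hypothesis H_gt0 : (0 < H)%N.
Context {n : nat} (idx : 'I_n -> @label S L H).
Hypothesis idx_bij : bijective idx.

(* A top piece between two pillars is the only kind of block that is wider than
   one unit and touches neither of the two extreme coordinates. *)
Lemma isomorphic_next_in_row :
  isomorphic
    (dissection_graph (pillar_floorplan (R := R) pos_inj px_odd py_odd px_lt
       py_lt L_gt0 H_gt0 idx_bij) xdir)
    (dissection_graph (pillar_floorplan (R := R) pos_inj' px_odd' py_odd' px_lt'
       py_lt' L_gt0 H_gt0 idx_bij) xdir) ->
  forall s t, next_in_row px py s t -> ((px s).+2 < px t)%N ->
  exists s' t', [/\ next_in_row px' py' s' t', px' s' = px s & px' t' = px t].
Proof.
move=> iso s t [st lt_st between] wide.
have [unidx idxK unidxK] := idx_bij.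
have [psi psiP] : exists psi : 'I_n -> 'I_n, forall i,
    (0 < label_lo px py (idx i) xdir)%N -> (label_hi px py (idx i) xdir < L)%N ->
    label_lo px' py' (idx (psi i)) xdir = label_lo px py (idx i) xdir /\
    label_hi px' py' (idx (psi i)) xdir = label_hi px py (idx i) xdir.
  apply: (isomorphism_keeps_ranges (L := L)
    (lF := fun i => label_lo px py (idx i) xdir)
    (hF := fun i => label_hi px py (idx i) xdir)
    (lG := fun i => label_lo px' py' (idx i) xdir)
    (hG := fun i => label_hi px' py' (idx i) xdir) _ _ _ _ _ _ _ iso) => //.
  - by move=> i; have /andP[] := label_bounds px_odd' py_odd' px_lt' py_lt' L_gt0 H_gt0
      (idx i) xdir.
  - by move=> x xL; exists (unidx (inl (inr (inr (Ordinal xL))))); rewrite unidxK.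
  - exact: pillar_one_plane.
have endE : piece_end py px L (inl s : @piece S H) = px t.
  rewrite /piece_end /=; apply: run_end_unique => //; first exact: ltnW.
    move=> k kst; apply/negP => /occP[r [rs rk]].
    by have := between r rs; rewrite rk; lia.
  by apply/occP; exists t.
have := psiP (unidx (inr (inl s))); rewrite unidxK /= /vec3 /= endE.
case=> //; first exact: ltnW.
(* The range is wider than one unit and does not start at 0, which leaves only the top piece that
   follows a pillar [s']. *)
case: (idx (psi _)) => [[s'|t']|[s'|y]]; rewrite /= /vec3 /=; try by lia.
move=> [ss'] e'.
have {}e' : run_end (occ py' px' (py' s')) L (px' s').+1 = px t := e'.
have : occ py' px' (py' s') (px t).
  by rewrite -e'; apply: run_end_stop; rewrite e'; exact: ltnW.
case/occP => t' [tt' xt']; exists s', t'; split=> //; split=> //.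
  by rewrite ss' xt'.
move=> r rs; apply/negP => /andP[sr rt].
have := @run_end_before (occ py' px' (py' s')) L (px' s').+1 (px' r).
rewrite sr e' -xt' rt => /(_ isT)/negP; apply.
by apply/occP; exists r.
Qed.

End PillarRecovery.

(** * Finiteness and counting of the classes *)

Section FiniteClasses.
Context {R : realType} {n : nat}.

Lemma graph_ofP (po : face n -> {set face n}) f : [exists g, po f == po g].
Proof. by apply/existsP; exists f. Qed.

(** Depends on the map from faces to planes alone, so that equal maps give equal graphs in spite of
    the dependent type of vertices. *)
Definition graph_of (po : face n -> {set face n}) : multidigraph :=
  @Multidigraph {P : {set face n} | [exists f, P == po f]} 'I_n
    (fun i => exist _ (po (i, false)) (graph_ofP po (i, false)))
    (fun i => exist _ (po (i, true)) (graph_ofP po (i, true))).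

Lemma dissection_graphE (F : floorplan R n) d :
  dissection_graph F d = graph_of (plane_of F d).
Proof.
rewrite /dissection_graph /graph_of /dissection_plane.
by congr Multidigraph; apply/funext => i; apply: val_inj.
Qed.

(** A class is determined by the planes of the faces in the three directions, which range over a
    finite type. *)
Lemma T_classes_finite : finite_set (@T_classes R n).
Proof.
pose code (F : floorplan R n) : {ffun 'I_3 * face n -> {set face n}} :=
  [ffun x => plane_of F x.1 x.2].
have codeE F F' : code F = code F' -> equivalence_class F = equivalence_class F'.
  move=> FF'; have E d : dissection_graph F d = dissection_graph F' d.
    rewrite !dissection_graphE; congr graph_of; apply/funext => f.
    by have /ffunP/(_ (d, f)) := FF'; rewrite !ffunE.
  by apply/seteqP; split=> G [? FG]; split=> // d; have := FG d; rewrite E.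
pose decode c : set (floorplan R n) :=
  if pselect (exists F, code F = c) is left ex
  then equivalence_class (projT1 (cid ex)) else set0.
apply: (@sub_finite_set _ _ (decode @` setT)); last exact/finite_image/finite_finset.
move=> _ [F _ <-]; exists (code F) => //; rewrite /decode.
case: pselect => [ex|]; last by case; exists F.
by apply: codeE; case: (cid ex).
Qed.

Lemma topologically_equivalent_refl (F : floorplan R n) : topologically_equivalent F F.
Proof. by move=> d; exists id, id; split=> //; exists id. Qed.

Lemma card_T_ge (T : finType) (F : T -> floorplan R n) :
  (forall t, generic_two_layer (F t)) ->
  (forall t t', topologically_equivalent (F t) (F t') -> t = t') ->
  (#|T| <= card_T R n)%N.
Proof.
move=> gF injF; pose c t := equivalence_class (F t).
have cinj : injective c.
  move=> t t' E; apply: injF.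
  have : c t' (F t') by split=> //; exact: topologically_equivalent_refl.
  by rewrite -E => -[].
rewrite cardE -(size_map c); apply: uniq_leq_size.
  by rewrite (map_inj_uniq cinj) enum_uniq.
move=> _ /mapP[t _ ->]; rewrite in_fset_set; last exact: T_classes_finite.
by apply/mem_set; exists (F t).
Qed.

End FiniteClasses.

(** * The layout of the pillars and the recovery of its permutations *)

Lemma euclid_inj A q q' r r' : (r < A)%N -> (r' < A)%N ->
  (q * A + r = q' * A + r')%N -> q = q' /\ r = r'.
Proof.
move=> rA r'A E; have A0 : (0 < A)%N by lia.
have : q = q' by have := congr1 (divn^~ A) E; rewrite !divnMDl // !divn_small // !addn0.
by move=> qq; split=> //; move: E; rewrite qq => /addnI.
Qed.

Lemma digits_lt c m p P : (c < m)%N -> (p < P)%N -> (c * P + p < m * P)%N.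
Proof.
move=> cm pP; have : (c.+1 * P <= m * P)%N by rewrite leq_mul2r cm orbT.
by rewrite mulSn; lia.
Qed.

Section Layout.
Context (m P e : nat).

(* Group j of the pillars has one pillar in each of the m * m * P rows (i, k, a),
   and these pillars share m * P columns: those of the rows with the same i if j
   is even, or the same k if j is odd, are put in a common set of P columns. *)
Definition row := ('I_m * 'I_m * 'I_P)%type.
Definition site := ('I_m.+1 * row)%type.
Definition twist := {ffun 'I_m * 'I_m * 'I_m -> {perm 'I_P}}.

Definition row_index (r : row) : nat := ((r.1.1 * m + r.1.2) * P + r.2)%N.

(** Group 0 is untwisted and starts the recovery; group [j'.+1] uses the permutations of index [j'].
    The default of [insub] is never met for groups up to [m]. *)
Definition place (th : twist) (j : nat) (r : row) : 'I_P :=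
  if j is j'.+1 then
    if insub j' is Some o then th (o, r.1.1, r.1.2) r.2 else r.2
  else r.2.

Definition column_class (j : nat) (r : row) : nat := if odd j then r.1.2 else r.1.1.

Definition column_offset (th : twist) (j : nat) (r : row) : nat :=
  (column_class j r * P + place th j r)%N.

(** The successor leaves a spare column after each group, so that the top piece between consecutive
    pillars of a row is wider than one unit. *)
Definition column (th : twist) (j : nat) (r : row) : nat :=
  (j * (m * P).+1 + column_offset th j r)%N.

Definition site_x (th : twist) (s : site) : nat := (column th s.1 s.2).*2.+1.
Definition site_y (s : site) : nat := (row_index s.2).*2.+1.

(** The [e] extra columns carry no pillar and add one block each, which allows any large enough
    number of blocks. *)
Definition layout_length : nat := ((m.+1 * (m * P).+1).*2.+1 + e)%N.
Definition layout_height : nat := (m * m * P).*2.+1.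

Lemma row_index_lt r : (row_index r < m * m * P)%N.
Proof. by apply: digits_lt => //; apply: digits_lt. Qed.

Lemma row_index_inj : injective row_index.
Proof.
move=> [[i k] a] [[i' k'] a'] /euclid_inj[] // /euclid_inj[] // ii kk aa.
by congr (_, _, _); apply: val_inj.
Qed.

Lemma column_offset_lt th j r : (column_offset th j r < m * P)%N.
Proof. by apply: digits_lt => //; rewrite /column_class; case: ifP. Qed.

Lemma column_inj th th' j j' r r' : column th j r = column th' j' r' ->
  [/\ j = j', column_class j r = column_class j r' &
      place th j r = place th' j r'].
Proof.
case/euclid_inj; try exact/ltnW/column_offset_lt.
by move=> <- /euclid_inj[] // -> /val_inj ->.
Qed.

Lemma column_gap th j j' r : (j < j')%N -> ((column th j r).+1 < column th j' r)%N.
Proof.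
move=> jj; have := column_offset_lt th j r; rewrite /column.
have : (j.+1 * (m * P).+1 <= j' * (m * P).+1)%N by rewrite leq_mul2r jj orbT.
by rewrite mulSn; lia.
Qed.

Lemma site_inj th s t : site_x th s = site_x th t -> site_y s = site_y t -> s = t.
Proof.
case: s t => [j r] [j' r']; rewrite /site_x /site_y /= => -[cc] [rr].
have {}rr : r = r' by apply: row_index_inj; lia.
have /column_inj[jj _ _] : column th j r = column th j' r' by lia.
by rewrite rr (val_inj jj).
Qed.

Lemma site_x_odd th s : odd (site_x th s).
Proof. by rewrite /site_x /= odd_double. Qed.

Lemma site_y_odd s : odd (site_y s).
Proof. by rewrite /site_y /= odd_double. Qed.

Lemma site_x_lt th s : ((site_x th s).+1 < layout_length)%N.
Proof.
case: s => j r; rewrite /site_x /layout_length /=.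
have : (column th j r < m.+1 * (m * P).+1)%N.
  by apply: digits_lt => //; apply/ltnW/column_offset_lt.
lia.
Qed.

Lemma site_y_lt s : ((site_y s).+1 < layout_height)%N.
Proof. by rewrite /site_y /layout_height; have := row_index_lt s.2; lia. Qed.

Lemma layout_length_gt0 : (0 < layout_length)%N. Proof. by []. Qed.
Lemma layout_height_gt0 : (0 < layout_height)%N. Proof. by []. Qed.

Lemma next_site th (j j' : 'I_m.+1) r : j' = j.+1 :> nat ->
  next_in_row (site_x th) site_y (j, r) (j', r) /\
  ((site_x th (j, r)).+2 < site_x th (j', r))%N.
Proof.
move=> jj; have gap := @column_gap th j j' r; rewrite jj ltnSn in gap.
split; last by rewrite /site_x /= jj; have := gap isT; lia.
split=> //; first by rewrite /site_x /= jj; have := gap isT; lia.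
case=> j1 r1; rewrite /site_y /site_x /= => rr.
have -> : r1 = r by apply: row_index_inj; lia.
apply/negP => /andP[a b].
have : (j < j1)%N.
  rewrite ltnNge; apply/negP; rewrite leq_eqVlt => /orP[/eqP|/(column_gap th r)].
    by move=> E; rewrite E ltnn in a.
  by lia.
have : (j1 < j')%N.
  rewrite ltnNge; apply/negP; rewrite leq_eqVlt => /orP[/eqP|/(column_gap th r)].
    by move=> E; rewrite E ltnn in b.
  by lia.
by rewrite jj; lia.
Qed.

(** Induction on the group: once the places in group [j] agree, the pair of abscissae of a row in
    groups [j] and [j.+1] identifies the row, and its second member gives the place in group
    [j.+1]. *)
Lemma twist_recovery (th th' : twist) :
  (forall s t, next_in_row (site_x th) site_y s t ->
     ((site_x th s).+2 < site_x th t)%N ->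
     exists s' t', [/\ next_in_row (site_x th') site_y s' t',
       site_x th' s' = site_x th s & site_x th' t' = site_x th t]) ->
  th = th'.
Proof.
move=> rec.
have places j r : (j <= m)%N -> place th j r = place th' j r.
  elim: j r => // j IH r jm.
  have jlt : (j < m.+1)%N by lia.
  have [nx wd] := @next_site th (Ordinal jlt) (Ordinal (jm : (j.+1 < m.+1)%N)) r erefl.
  have [[j1 r1] [[j2 r2] [[rr _ _] x1 x2]]] := rec _ _ nx wd.
  have {}rr : r1 = r2 by apply: row_index_inj; move: rr; rewrite /site_y /=; lia.
  have /column_inj[jj c1 p1] : column th' j1 r1 = column th j r.
    by move: x1; rewrite /site_x /=; lia.
  have /column_inj[jj' c2 p2] : column th' j2 r1 = column th j.+1 r.
    by move: x2; rewrite rr /site_x /=; lia.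
  rewrite jj in c1 p1; rewrite jj' in c2 p2.
  (* Of two consecutive groups one is even and reveals the first index, the other is odd and reveals
     the second. *)
  have : r1.1 = r.1.
    move: c1 c2; rewrite /column_class /=; case: (odd j) => /= c1 c2;
    by apply/eqP; rewrite -pair_eqE /= -!val_eqE /= c1 c2 !eqxx.
  move=> r11; rewrite IH in p1; last by lia.
  (* In group 0 the place is the last index itself; later it is the image of that index under a
     permutation, the same for [r1] and [r]. *)
  have r12 : r1.2 = r.2.
    move: p1; rewrite /place; case: (j) => // j0; rewrite r11.
    by case: insub => // o /perm_inj.
  rewrite -p2; suff -> : r1 = r by [].
  by case: (r1) (r) r11 r12 => u v [u1 v1] /= -> ->.
apply/ffunP => - [[g i] k]; apply/permP => a.
have := places g.+1 (i, k, a) (ltn_ord g); rewrite /place /=.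
by rewrite valK.
Qed.

(** Each pillar counts for itself and for the two pieces that start after it; each column and each
    row adds its initial piece. *)
Lemma card_label : #|{: @label site layout_length layout_height}| =
  (3 * (m.+1 * (m * m * P)) + layout_length + layout_height)%N.
Proof. by rewrite !card_sum !card_prod !card_ord; lia. Qed.

Lemma card_T_layout (R : realType) n :
  n = (3 * (m.+1 * (m * m * P)) + layout_length + layout_height)%N ->
  (P`! ^ (m * m * m) <= card_T R n)%N.
Proof.
rewrite -card_label => nE.
pose idx (i : 'I_n) : @label site layout_length layout_height :=
  enum_val (cast_ord nE i).
have idx_bij : bijective idx.
  exists (fun b => cast_ord (esym nE) (enum_rank b)) => [i|b]; rewrite /idx.
    by rewrite enum_valK cast_ordK.
  by rewrite cast_ordKV enum_rankK.
pose F (th : twist) : floorplan R n := pillar_floorplan (R := R)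
  (@site_inj th) (@site_x_odd th) site_y_odd (@site_x_lt th) site_y_lt
  layout_length_gt0 layout_height_gt0 idx_bij.
have -> : (P`! ^ (m * m * m))%N = #|{: twist}|.
  by rewrite card_ffun !card_prod !card_ord card_Sn.
apply: (card_T_ge (F := F)) => [th|th th' /(_ xdir) iso].
  exact: pillar_generic_two_layer.
exact/twist_recovery/(isomorphic_next_in_row iso).
Qed.

End Layout.

(** * Asymptotic estimates *)

Lemma natr_le_ex (R : realType) (x : R) : exists N : nat, x <= N%:R.
Proof.
exists (Num.bound (Num.max x 0)).
have /ltW : Num.max x 0 < (Num.bound (Num.max x 0))%:R.
  by apply: archi_boundP; rewrite le_max lexx orbT.
by apply: le_trans; rewrite le_max lexx.
Qed.

Lemma ln_natr_ge0 (R : realType) (n : nat) : 0 <= ln (n%:R : R).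
Proof. by case: n => [|n]; [rewrite ln0|apply: ln_ge0; rewrite ler1n]. Qed.

(** A weak Stirling bound; the induction step rests on [q * ln (1 + 1 / q) <= 1]. *)
Lemma ln_fact_ge (R : realType) (p : nat) : (0 < p)%N ->
  p%:R * (ln (p%:R : R) - 1) <= ln (p`!%:R : R).
Proof.
elim: p => // -[|p] IH _; first by rewrite (_ : 1`! = 1%N) // ln1; lra.
have {IH} := IH isT; set q := p.+1; have q0 : 0 < (q%:R : R) by rewrite ltr0n.
rewrite factS natrM lnM ?posrE ?ltr0n ?fact_gt0 //.
have lnE : ln (q.+1%:R : R) = ln q%:R + ln (1 + q%:R^-1).
  rewrite -lnM ?posrE ?addr_gt0 ?invr_gt0 //; congr ln.
  by rewrite mulrDr mulr1 divff ?gt_eqF // natr1.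
have : q%:R * ln (1 + (q%:R : R)^-1) <= 1.
  rewrite mulrC -ler_pdivlMr // mul1r; apply: le_ln1Dx.
  by rewrite (lt_trans _ (_ : 0 < _)) ?invr_gt0 ?ltrN10.
rewrite lnE -natr1.
move: (ln (1 + (q%:R : R)^-1)) (ln (q%:R : R)) (ln (q`!%:R : R)) => a b c.
by move: (q%:R : R) => x; lra.
Qed.

(* The number of blocks of a layout with parameters m, P, e is
   P * slope m + 2 * m + 4 + e. *)
Definition slope (m : nat) : nat := (3 * (m * m * m) + 7 * (m * m) + 2 * m)%N.

Lemma ln_card_T_ge (R : realType) (m P n : nat) : (0 < P)%N ->
  (P * slope m + (2 * m + 4) <= n)%N ->
  (m * m * m)%:R * (P%:R * (ln (P%:R : R) - 1)) <= ln ((card_T R n)%:R : R).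
Proof.
move=> P0 Pn; have := @card_T_layout m P (n - (P * slope m + (2 * m + 4))) R n.
rewrite /layout_length /layout_height.
have -> : (3 * (m.+1 * (m * m * P)) + ((m.+1 * (m * P).+1).*2.+1 +
  (n - (P * slope m + (2 * m + 4)))) + (m * m * P).*2.+1)%N = n.
  have -> : (m.+1 * (m * P).+1).*2 = (2 * (P * (m * m)) + 2 * (P * m) + 2 * m + 2)%N by lia.
  have E : (P * slope m)%N =
      (3 * (P * (m * m * m)) + 7 * (P * (m * m)) + 2 * (P * m))%N.
    by rewrite /slope; lia.
  by move: Pn; rewrite E; lia.
move=> /(_ erefl); rewrite -(ler_nat R) natrX => cardP.
have f0 : 0 < (P`!%:R : R) by rewrite ltr0n fact_gt0.
apply: le_trans (_ : ln ((P`!%:R : R) ^+ (m * m * m)) <= _); last first.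
  by rewrite ler_ln // posrE ?exprn_gt0 // (lt_le_trans _ cardP) // exprn_gt0.
by rewrite lnXn // -[leRHS]mulr_natl ler_wpM2l // ln_fact_ge.
Qed.

(** With [m] fixed of order [1 / eps] and [P] about [n / slope m], [ln P] is equivalent to [ln n],
    and the ratio of [m ^ 3] to [slope m] is close to 1/3. *)
Lemma ln_card_T_eventually (R : realType) (eps : R) : 0 < eps ->
  exists N : nat, forall n, (N <= n)%N ->
    (3^-1 - eps) * (n%:R * ln n%:R) <= ln ((card_T R n)%:R : R).
Proof.
move=> eps0.
have [eps3|eps3] := leP 3^-1 eps.
  exists 0%N => n _; apply: le_trans (ln_natr_ge0 _ _).
  by rewrite mulr_le0_ge0 ?subr_le0 // mulr_ge0 // ln_natr_ge0.
have [m' m'P] := natr_le_ex (5 / eps); set m := m'.+1.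
pose d : R := m%:R^-1.
have m0 : 0 < (m%:R : R) by rewrite ltr0n.
have d0 : 0 < d by rewrite invr_gt0.
have md : m%:R * d = 1 by rewrite mulfV // gt_eqF.
have d1 : d <= 1 by rewrite invf_le1 // ler1n.
have d5 : 5 * d <= eps.
  rewrite ler_pdivrMr // mulrC -ler_pdivrMr //; apply: le_trans m'P _.
  by rewrite ler_nat leqnSn.
pose c : R := (slope m)%:R; pose k : R := (slope m + (2 * m + 4))%:R.
have c0 : 0 < c by rewrite ltr0n /slope; lia.
(* One factor [1 + d] pays for [n] against [c * P], the other for [ln n] against [ln P - 1]. The
   choice [5 * d <= eps] suffices because [(1/3 - 5 d) (1 + 3 d) (3 + 9 d) <= 1]. *)
have slope_le : (3^-1 - eps) * (1 + d) ^+ 2 * c <= (m * m * m)%:R.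
  have -> : c = m%:R ^+ 3 * (3 + 7 * d + 2 * d ^+ 2).
    rewrite /c /slope !natrD !natrM.
    have E2 : m%:R ^+ 2 = m%:R ^+ 3 * d by rewrite [_ ^+ 3]exprSr -mulrA md mulr1.
    have E1 : m%:R = m%:R ^+ 3 * d ^+ 2 by rewrite expr2 mulrA -E2 expr2 -mulrA md mulr1.
    by rewrite -!expr2 -exprSr E2 {3}E1; ring.
  rewrite !natrM -expr2 -exprSr mulrCA -[leRHS]mulr1 ler_wpM2l ?exprn_ge0 ?(ltW m0) //.
  apply: le_trans (_ : (3^-1 - 5 * d) * (1 + 3 * d) * (3 + 9 * d) <= _).
    have dd : d ^+ 2 <= d by rewrite expr2 ler_piMl // ltW.
    have dd0 : 0 <= d ^+ 2 by exact: sqr_ge0.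
    have e0 : 0 <= 3^-1 - eps by lra.
    have s1 : 0 <= (1 + d) ^+ 2 by exact: sqr_ge0.
    have s2 : (1 + d) ^+ 2 <= 1 + 3 * d by lra.
    by apply: ler_pM; [exact: mulr_ge0 | lra | apply: ler_pM => //; lra | lra].
  by nra.
(* [ln P >= T] is equivalent to [ln (2 * c * P) <= (1 + d) * (ln P - 1)]. *)
pose T := (1 + d + ln (2 * c)) / d.
(* Beyond [P1] the rounding loss [k] is at most [d * c * P]. *)
have [P1 P1P] := natr_le_ex (k / (d * c)).
have [P2 P2P] := natr_le_ex (expR T).
pose P0 := maxn (maxn P1 P2) 1.
exists (P0 * slope m + (2 * m + 4))%N => n nN.
pose P := ((n - (2 * m + 4)) %/ slope m)%N.
have s0 : (0 < slope m)%N by rewrite /slope; lia.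
have PP0 : (P0 <= P)%N by rewrite leq_divRL //; lia.
have Pn : (P * slope m + (2 * m + 4) <= n)%N.
  by have := leq_trunc_div (n - (2 * m + 4)) (slope m); rewrite -/P; lia.
have nP : (n <= slope m * P + (slope m + (2 * m + 4)))%N.
  by have := ltn_ceil (n - (2 * m + 4)) s0; rewrite -/P; lia.
have Ppos : (0 < P)%N by apply: leq_trans PP0; rewrite leq_max orbT.
have p0 : 0 < (P%:R : R) by rewrite ltr0n.
apply: le_trans (ln_card_T_ge R Ppos Pn).
have n0 : 0 < (n%:R : R) by rewrite ltr0n; lia.
have kd : k <= d * (c * P%:R).
  have : k / (d * c) <= P%:R.
    by apply: le_trans P1P _; rewrite ler_nat; apply: leq_trans PP0; rewrite !leq_max leqnn.
  by rewrite ler_pdivrMr ?mulr_gt0 // mulrC mulrA.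
have x_le : n%:R <= (1 + d) * (c * P%:R).
  have : (n%:R : R) <= c * P%:R + k by rewrite -natrM -natrD ler_nat.
  by move: kd; move: (c * _) => y; lra.
have lnP : T <= ln (P%:R : R).
  rewrite -[T]expRK ler_ln ?posrE ?expR_gt0 //; apply: le_trans P2P _.
  by rewrite ler_nat; apply: leq_trans PP0; rewrite !leq_max leqnn orbT.
have ln_le : ln (n%:R : R) <= (1 + d) * (ln (P%:R : R) - 1).
  apply: le_trans (_ : ln (2 * c * P%:R) <= _).
    rewrite ler_ln ?posrE ?mulr_gt0 //; apply: le_trans x_le _.
    by rewrite -mulrA ler_wpM2r ?mulr_ge0 ?ltW //; lra.
  rewrite lnM ?posrE ?mulr_gt0 //; move: lnP; rewrite ler_pdivrMr //.
  move: (ln (2 * c)) (ln (P%:R : R)) => a b; lra.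
have lp0 : 0 <= ln (P%:R : R) - 1.
  have : 0 <= (1 + d) * (ln (P%:R : R) - 1) by apply: le_trans ln_le; exact: ln_natr_ge0.
  by rewrite pmulr_rge0 ?addr_gt0.
have prod_le : n%:R * ln (n%:R : R) <= (1 + d) ^+ 2 * c * (P%:R * (ln (P%:R : R) - 1)).
  apply: le_trans (ler_pM _ _ x_le ln_le) _; rewrite ?ln_natr_ge0 //.
  rewrite le_eqVlt; apply/orP; left; apply/eqP; ring.
apply: le_trans (_ : (3^-1 - eps) * ((1 + d) ^+ 2 * c * (P%:R * (ln (P%:R : R) - 1))) <= _).
  by rewrite ler_wpM2l // subr_ge0 ltW.
by rewrite [leLHS]mulrA ler_wpM2r ?mulr_ge0 // mulrA.
Qed.

Theorem theorem2 (R : realType) :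
  exists e : nat -> R,
    e n @[n --> \oo] --> (0 : R) /\
    forall n : nat, (0 < n)%N ->
      (3^-1 - e n) * n%:R * ln n%:R <= ln ((card_T R n)%:R : R).
Proof.
(* The positive part of the deficit. For [n = 1] the quotient divides by zero, but the left side of
   the bound vanishes there. *)
pose e (n : nat) : R :=
  Num.max 0 (3^-1 - ln ((card_T R n)%:R : R) / (n%:R * ln n%:R)).
exists e; split; last first.
  move=> n n0; rewrite -mulrA; have [n1|n1] := leqP n 1.
    have -> : n = 1%N by lia.
    by rewrite ln1 mulr0 mulr0 ln_natr_ge0.
  have x0 : 0 < n%:R * ln (n%:R : R).
    by rewrite mulr_gt0 ?ltr0n // ln_gt0 // ltr1n.
  rewrite -ler_pdivlMr // lerBlDr -lerBlDl.
  by rewrite /e le_max lexx orbT.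
apply/cvgrPdist_le => eps eps0; have [N NP] := ln_card_T_eventually eps0.
exists (maxn N 2) => // n /=; rewrite geq_max => /andP[/NP card_ge n2].
have x0 : 0 < n%:R * ln (n%:R : R).
  by rewrite mulr_gt0 ?ltr0n ?ln_gt0 ?ltr1n //; lia.
rewrite sub0r normrN ger0_norm ?le_max ?lexx // ge_max (ltW eps0) /=.
by rewrite lerBlDr -lerBlDl ler_pdivlMr.
Qed.
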